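(* Let $\nu$ be a positive $\sigma$-finite Borel measure on $\mathbb R$ with $\int_{\mathbb R}u^2\,\nu(du)=1$ and $\int_{\mathbb R}|u|^3\,\nu(du)<\infty$, let $\widehat N$ be a compensated Poisson random measure on $\mathbb R\times\mathbb R$ with control measure $\nu(du)\,dx$, let $\lambda>0$, and let $$Y_t^\lambda=\sqrt{2\lambda}\int_{-\infty}^t\int_{\mathbb R}u\,e^{-\lambda(t-x)}\,\widehat N(du,dx),\qquad t\ge 0.$$ Then, as $T\to\infty$, $$\frac1{\sqrt T}\int_0^T Y_t^\lambda\,dt\;\to\;\mathcal N(0,\sigma^2(\lambda))\quad\text{in law},$$ where $\mathcal N(0,\sigma^2(\lambda))$ is a centered Gaussian random variable with variance $\sigma^2(\lambda)=2\lambda^{-1}$.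
   Context: A compensated Poisson random measure on a measurable space $(Z,\mathcal Z)$ with ($\sigma$-finite, non-atomic) control measure $\mu$ is a collection of random variables $\{\widehat N(B):B\in\mathcal Z,\ \mu(B)<\infty\}$ such that $\widehat N(B)$ and $\widehat N(C)$ are independent whenever $B\cap C=\varnothing$, and $\widehat N(B)$ has the law of $\mathfrak P(B)-\mu(B)$, with $\mathfrak P(B)$ Poisson with parameter $\mu(B)$. The integral $\int h\,d\widehat N$, $h\in L^2(\mu)$, is the Wiener–Itô integral, i.e. the linear isometry $L^2(\mu)\to L^2(\mathbb P)$ mapping $\mathbf 1_B$ to $\widehat N(B)$. Here $Z=\mathbb R\times\mathbb R$ and $\mu(du,dx)=\nu(du)\,dx$. Integrals in $t$ of the process are taken for a jointly measurable version (equivalently, as mean-square integrals). *)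

(* Defs.v *)
From HB Require Import structures.
From mathcomp Require Import all_boot all_order all_algebra.
From mathcomp Require Import all_classical all_reals all_analysis.

Set Implicit Arguments.
Unset Strict Implicit.
Unset Printing Implicit Defensive.

Import Order.TTheory GRing.Theory Num.Theory.
Import numFieldNormedType.Exports.

Local Open Scope classical_set_scope.
Local Open Scope ring_scope.

Definition independent_RV (d : measure_display) (Omega : measurableType d)
    (R : realType) (P : probability Omega R) (X Y : {RV P >-> R}) : Prop :=
  forall A B : set R, measurable A -> measurable B ->
    (P (X @^-1` A `&` Y @^-1` B) = P (X @^-1` A) * P (Y @^-1` B))%E.

(* [N B] is constrained only for measurable [B] of finite [mu]-measure. The
   second argument of [poisson_prob] is a dummy, and [poisson_prob 0 _] is the
   Dirac mass at 0, so [mu B = 0] is covered. *)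
Definition compensated_poisson_measure (dZ d : measure_display)
    (Z : measurableType dZ) (Omega : measurableType d) (R : realType)
    (mu : {measure set Z -> \bar R}) (P : probability Omega R)
    (N : set Z -> {RV P >-> R}) : Prop :=
  (forall B C : set Z, measurable B -> measurable C ->
     (mu B < +oo)%E -> (mu C < +oo)%E -> B `&` C = set0 ->
     independent_RV (N B) (N C)) /\
  (forall B : set Z, measurable B -> (mu B < +oo)%E ->
     forall A : set R, measurable A ->
       distribution P (N B) A =
       pushforward (poisson_prob (fine (mu B)) 0%N)
         (fun k : nat => k%:R - fine (mu B)) A).

(* Elements of L^2 are represented by functions, hence equalities in L^2(P)
   are almost sure ones. [J] is irrelevant outside L^2(mu); on L^2(mu) these
   conditions determine it up to almost sure equality. *)
Definition wiener_ito_integral (dZ d : measure_display)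
    (Z : measurableType dZ) (Omega : measurableType d) (R : realType)
    (mu : {measure set Z -> \bar R}) (P : probability Omega R)
    (N : set Z -> {RV P >-> R}) (J : (Z -> R) -> Omega -> R) : Prop :=
  [/\ forall h, h \in Lfun mu 2%:E -> J h \in Lfun P 2%:E,
      forall (a : R) (h k : Z -> R),
        h \in Lfun mu 2%:E -> k \in Lfun mu 2%:E ->
        {ae P, forall w, J (fun z => a * h z + k z) w = a * J h w + J k w},
      forall h, h \in Lfun mu 2%:E ->
        'N[P]_2%:E[EFin \o J h]%E = 'N[mu]_2%:E[EFin \o h]%E &
      forall B : set Z, measurable B -> (mu B < +oo)%E ->
        {ae P, forall w, J (\1_B) w = N B w}].

(* A point of the plane is [z = (u, x)], with jump size [u] and time [x]. *)
Definition ou_kernel (R : realType) (lambda t : R) (z : R * R) : R :=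
  if z.2 <= t then z.1 * expR (- lambda * (t - z.2)) else 0.

(* Weak convergence of the laws of [X t], [t --> +oo], to [Q]. Measurability of
   [X t] is part of the definition because [X] is only given as a family of
   functions; the library puts its laws on the real line on [measurableTypeR R],
   which is [R] with its Borel sets. *)
Definition cvg_in_law (d : measure_display) (Omega : measurableType d)
    (R : realType) (P : probability Omega R) (X : R -> Omega -> R)
    (Q : probability (measurableTypeR R) R) : Prop :=
  (\forall t \near +oo, measurable_fun setT (X t)) /\
  (forall f : R -> R, continuous f -> (exists M : R, forall x, `|f x| <= M) ->
     'E_P[f \o X t]%E @[t --> +oo] --> (\int[Q]_x (f x)%:E)%E).

(* Main.v *)
Require Import Defs.
From HB Require Import structures.
From mathcomp Require Import all_boot all_order all_algebra.
From mathcomp Require Import all_classical all_reals all_analysis.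
From mathcomp Require Import measurable_realfun ring lra.

Set Implicit Arguments.
Unset Strict Implicit.
Unset Printing Implicit Defensive.

Import Order.TTheory GRing.Theory Num.Theory.
Import numFieldNormedType.Exports.

Local Open Scope classical_set_scope.
Local Open Scope ring_scope.

(* The time average is a single Wiener-Ito integral [T^(-1/2) J H], where
   [H (u, x)] is [sqrt (2 lambda) u] times the integral of
   [exp (- lambda (t - x))] over [max 0 x <= t <= T]. Here [int H^2] is
   [(2 / lambda) T + O(1)] and [int |H|^3] is [O(T)], so that the theorem follows
   from the Lyapunov type bound
     [|E cos (th J h + al) - exp (- th^2 int h^2 / 2) cos al| <= 8 |th|^3 int |h|^3].

   The interchange of [J] with the time integral only uses that [J] preserves
   inner products.

   For the bound, [h] is approximated by step functions with pieces of small
   measure. Independence of pairs [N B], [N C] would not give the joint law of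
   the [N (B i)]. But [N] is additive, as [J] is linear, so [N] takes its least
   value [- mu B] on a disjoint union [B] if and only if it does so on each piece. As
   this event has probability [exp (- mu B)], the indicators of the events
   [N (B i) <> - mu (B i)] are mutually independent. A small piece has mostly at
   most one point, so that these indicators are nearly the [N (B i) + mu (B i)].

   Convergence of all [E cos (th X + al)] and a bound on second moments give
   convergence in law: a bounded continuous function is uniformly close on a
   segment to a Bernstein polynomial in [sin (c x)], which is a trigonometric
   polynomial with the same bound on the whole line. *)

(** * Taylor estimates for the cosine *)

(** A free phase [al] accompanies the frequency [th] throughout. It replaces complex exponentials by
    real functions, and it lets the recursions close: one more indicator shifts the phase, and the
    product of a sine and a cosine is again a combination of cosines with phases. The approximating
    step functions do not depend on how finely time is cut. With such a function fixed, the time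
    slices are made thin: the probabilities of two points in one piece, of order [m i ^+ 2], then
    have a negligible sum, while the sum of the [m i] stays bounded. Only afterwards does the step
    function tend to [h]. The factor 8 is the cube of 2, as the step functions are bounded by
    [2 |h|]. With [th / sqrt T] in place of [th], a cube integral of order [T] leaves an error of
    order [T^(-1/2)]; this is the use of the third moment of [nu]. The limit variance is [2 lambda]
    times [lambda^(-2)], since the time integral of the exponential weight is close to [lambda^(-1)]
    on most of [[0, T]]. *)

Lemma norm_le_of_derive (R : realType) (n : nat) (F f : R -> R) :
  F 0 = 0 -> (forall x : R, is_derive x 1 F (f x)) ->
  (forall x, `|f x| <= `|x| ^+ n) -> forall b, `|F b| <= `|b| ^+ n.+1.
Proof.
move=> F0 dF fn b.
have cF x : {for x, continuous F}.
  by apply/differentiable_continuous/derivable1_diffP; case: (dF x).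
(* The mean value theorem yields [f c * b] with [c] between 0 and [b]. The factor [1 / n.+1] that
   integration would give is dropped, which only costs constants. *)
have key c : `|c| <= `|b| -> `|f c * b| <= `|b| ^+ n.+1.
  move=> cb; rewrite normrM exprSr ler_wpM2r//.
  by rewrite (le_trans (fn c))// lerXn2r// nnegrE.
have [b0|b0|<-] := ltgtP 0 b; last by rewrite F0 normr0.
- have [|c] := MVT b0 (fun x _ => dF x).
    by apply: continuous_subspaceT => x; exact: cF.
  rewrite in_itv/= => /andP[c0 cb]; rewrite F0 !subr0 => ->; apply: key.
  by rewrite !ger0_norm ?ltW.
- have [|c] := MVT b0 (fun x _ => dF x).
    by apply: continuous_subspaceT => x; exact: cF.
  rewrite in_itv/= => /andP[c0 cb]; rewrite F0 !sub0r => /eqP.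
  rewrite mulrN eqr_opp => /eqP ->; apply: key.
  by rewrite !ler0_norm ?ltW// ltrN2.
Qed.

Section cos_taylor.
Variable R : realType.
Implicit Types x b e : R.

Let is_derive_addl x b : is_derive b (1 : R) (fun c : R => x + c) 1.
Proof.
have := is_deriveD (is_derive_cst x b (1 : R)) (is_derive_id b (1 : R)).
by rewrite add0r.
Qed.

Let is_derive_cosD x b : is_derive b (1 : R) (fun c => cos (x + c)) (- sin (x + b)).
Proof.
have := @is_derive1_comp R cos _ b _ 1 (is_derive_cos _) (is_derive_addl x b).
by rewrite mulr1.
Qed.

Let is_derive_sinD x b : is_derive b (1 : R) (fun c => sin (x + c)) (cos (x + b)).
Proof.
have := @is_derive1_comp R sin _ b _ 1 (is_derive_sin _) (is_derive_addl x b).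
by rewrite mulr1.
Qed.

(** In this and the next estimates each remainder is, up to sign, the derivative of the following
    one, so that [norm_le_of_derive] raises the order by one each time. *)
Lemma cosD_taylor0 x b : `|cos (x + b) - cos x| <= `|b|.
Proof.
rewrite -[leRHS]expr1.
apply: (@norm_le_of_derive R 0 (fun c => cos (x + c) - cos x)
  (fun c => - sin (x + c))); first by rewrite addr0 subrr.
- move=> c; rewrite -[X in is_derive _ _ _ X]subr0.
  exact: is_deriveB (is_derive_cosD x c) (is_derive_cst _ _ _).
- by move=> c; rewrite normrN expr0 sin_max.
Qed.

Lemma sinD_taylor1 x b : `|sin (x + b) - sin x - b * cos x| <= `|b| ^+ 2.
Proof.
apply: (@norm_le_of_derive R 1 (fun c => sin (x + c) - sin x - c * cos x)
  (fun c => cos (x + c) - cos x)); first by rewrite addr0 subrr mul0r subrr.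
- move=> c; rewrite -[X in X - cos x]subr0.
  apply: (is_deriveB (is_deriveB (is_derive_sinD x c) (is_derive_cst _ _ _))).
  have := is_deriveM (is_derive_id c (1 : R)) (is_derive_cst (cos x) c (1 : R)).
  by rewrite scaler0 add0r [_ *: _]mulr1.
- by move=> c; rewrite expr1 cosD_taylor0.
Qed.

Lemma cosD_taylor1 x b : `|cos (x + b) - cos x + b * sin x| <= `|b| ^+ 2.
Proof.
(* A quarter period turns the estimate for the sine into one for the cosine. *)
have := sinD_taylor1 (x + pi / 2) b.
by rewrite [x + _ + b]addrAC !sinDpihalf cosDpihalf mulrN opprK.
Qed.

Lemma cosD_taylor2 x b :
  `|cos (x + b) - cos x + b * sin x + b ^+ 2 / 2 * cos x| <= `|b| ^+ 3.
Proof.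
rewrite -mulrA.
apply: (@norm_le_of_derive R 2
  (fun c => cos (x + c) - cos x + c * sin x + c ^+ 2 * (2^-1 * cos x))
  (fun c => - (sin (x + c) - sin x - c * cos x))).
- by rewrite addr0 subrr mul0r expr0n/= mul0r !addr0.
- move=> c.
  have d1 := is_deriveB (is_derive_cosD x c) (is_derive_cst (cos x) c (1 : R)).
  have d2 := is_deriveM (is_derive_id c (1 : R)) (is_derive_cst (sin x) c (1 : R)).
  have d3 := is_deriveM (is_deriveX 2 (is_derive_id c (1 : R)))
               (is_derive_cst (2^-1 * cos x) c (1 : R)).
  have := is_deriveD (is_deriveD d1 d2) d3.
  set f' := (X in is_derive _ _ _ X -> _).
  suff -> : f' = - (sin (x + c) - sin x - c * cos x) by [].
  have scaleE (k y : R) : k *: (y : R^o) = k * y by [].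
  by rewrite /f' !scaleE /cst/= expr1; field.
- by move=> c; rewrite normrN sinD_taylor1.
Qed.

(** The upper bound comes from [expR e >= 1 + e] and [(1 - e + e ^+ 2) * (1 + e) >= 1]. *)
Lemma expRN_bounds e : 0 <= e -> 1 - e <= expR (- e) <= 1 - e + e ^+ 2.
Proof.
move=> e0; rewrite expR_ge1Dx/=.
have e1 : 0 < 1 + e by rewrite ltr_pwDl.
rewrite expRN (@le_trans _ _ (1 + e)^-1)//.
  by rewrite lef_pV2 ?posrE ?expR_gt0// expR_ge1Dx.
rewrite -div1r ler_pdivrMr//.
have -> : (1 - e + e ^+ 2) * (1 + e) = 1 + e ^+ 3 by ring.
by rewrite lerDl exprn_ge0.
Qed.

(* One step of the recursion for the characteristic function of a compensated
   sum of independent indicators with success probabilities [1 - expR (- e)]. *)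
Lemma cos_poisson_step a b e : 0 <= e ->
  `|expR (- e) * cos (a - b * e) + (1 - expR (- e)) * cos (a + b - b * e)
    - expR (- (b ^+ 2 * e / 2)) * cos a|
  <= `|b| ^+ 3 * e + e ^+ 2 * (1 + `|b|) ^+ 4.
Proof.
move=> e0; set c := a - b * e.
have -> : a + b - b * e = c + b by rewrite /c addrAC.
have -> : cos a = cos (c + b * e) by rewrite subrK.
set E := expR (- e); set v := b ^+ 2 * e / 2; set V := expR (- v).
set B := `|b|; have B0 : 0 <= B by exact: normr_ge0.
have v0 : 0 <= v by rewrite divr_ge0// mulr_ge0// sqr_ge0.
have vB : v = B ^+ 2 * e / 2 by rewrite /B real_normK// num_real.
have r1 : `|E - (1 - e)| <= e ^+ 2.
  have /andP[] := expRN_bounds e0; rewrite -/E => ? ?.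
  by rewrite ler_norml; apply/andP; split; nra.
have r2 : `|V - (1 - v)| <= v ^+ 2.
  have /andP[] := expRN_bounds v0; rewrite -/V => ? ?.
  by rewrite ler_norml; apply/andP; split; nra.
have := cosD_taylor2 c b; have := cosD_taylor1 c (b * e).
have := cosD_taylor0 c (b * e); have := cosD_taylor0 c b.
rewrite -/B !normrM (ger0_norm e0) -/B.
have := cos_max (c + b * e).
move: (cos (c + b * e)) (cos c) (cos (c + b)) (sin c) => C2 C0 C1 S c2 t0 r5 r4 r3.
(* Replace [1 - E] by [e] and [V] by [1 - v]. The drift [b * e * S] cancels between jump and
   compensator, and the second order term [v * C0] of the jump cancels [v * C2] up to
   [v * (C2 - C0)]. The five summands are the remainders. *)
rewrite (_ : _ - _ = e * (C1 - C0 + b * S + b ^+ 2 / 2 * C0)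
  - (C2 - C0 + b * e * S) + v * (C2 - C0) + (E - (1 - e)) * (C0 - C1)
  - (V - (1 - v)) * C2); last by rewrite /v; field.
apply: (@le_trans _ _ (e * B ^+ 3 + (B * e) ^+ 2 + v * (B * e) + e ^+ 2 * B
  + v ^+ 2 * 1)).
  apply: (le_trans (ler_normB _ _)); apply: lerD; last by rewrite normrM ler_pM.
  apply: (le_trans (ler_normD _ _)); apply: lerD; last first.
    by rewrite normrM ler_pM// distrC.
  apply: (le_trans (ler_normD _ _)); apply: lerD; last first.
    by rewrite normrM (ger0_norm v0) ler_wpM2l.
  apply: (le_trans (ler_normB _ _)); apply: lerD => //.
  by rewrite normrM (ger0_norm e0) ler_wpM2l.
(* The terms in [B ^+ 3 * e] cancel, and what is left is [e ^+ 2] times a polynomial with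
   nonnegative coefficients; the fourth power in the statement is there to absorb [v ^+ 2]. *)
rewrite vB -subr_ge0.
rewrite (_ : _ - _ = e ^+ 2 * (1 + 3 * B + 5 * B ^+ 2 + 7 / 2 * B ^+ 3 + 3 / 4 * B ^+ 4)).
  by rewrite mulr_ge0 ?sqr_ge0// !addr_ge0// mulr_ge0// exprn_ge0.
by field.
Qed.

End cos_taylor.

(** * Convergence in law by trigonometric polynomials *)

(** Only [y] is confined to the segment: in [bernstein_approx] the point [x] is [k / n] for an
    arbitrary natural number [k]. *)
Lemma unif_continuous_segment (R : realType) (f : R -> R) (a b e : R) :
  continuous f -> 0 < e ->
  exists2 dl, 0 < dl & forall y x, a <= y <= b -> `|x - y| < dl -> `|f x - f y| < e.
Proof.
move=> cf e0.
pose P dl y := forall x, `|x - y| < dl -> `|f x - f y| < e.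
have cov : \forall dl \near 0^'+, `[a, b] `<=` P dl.
  have /compact_near_coveringP cov := @segment_compact R a b.
  apply: cov => y _.
  have e2 : 0 < e / 2 by rewrite divr_gt0.
  have /cvgrPdist_lt/(_ _ e2) /nbhs_ballP[r /= r0 Br] := cf y.
  exists (ball y (r / 2), [set dl | dl < r / 2]).
    by split; [apply: nbhsx_ballx|apply: nbhs_right_lt]; rewrite divr_gt0.
  move=> [y' dl] [/= yy' dlr] x xy'.
  have Hy' : `|f y - f y'| < e / 2.
    by apply: Br; rewrite /ball/= (lt_trans yy')// ltr_pdivrMr// ltr_pMr// ltr1n.
  have Hx : `|f y - f x| < e / 2.
    apply: Br; rewrite /ball/= [r]splitr (le_lt_trans (ler_distD y' _ _))// ltrD//.
    by rewrite distrC (lt_trans xy').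
  by rewrite [e]splitr (le_lt_trans (ler_distD (f y) _ _))// ltrD// distrC.
near ((0:R)^'+) => dl.
exists dl; first by near: dl; exact: nbhs_right_gt.
move=> y x yab; suff : P dl y by exact.
have /(_ y) : `[a, b] `<=` P dl by near: dl.
by apply; rewrite /= in_itv.
Unshelve. all: by end_near. Qed.

(* [bernstein n g y] is the mean of [g] under the binomial law of parameters
   [n] and [y], defined by conditioning on the first trial. *)
Fixpoint bernstein (R : realType) (n : nat) (g : nat -> R) (y : R) : R :=
  if n is m.+1 then (1 - y) * bernstein m g y + y * bernstein m (g \o S) y
  else g 0%N.

Section bernstein.
Variables (R : realType) (y : R).
Hypothesis y01 : 0 <= y <= 1.
Implicit Types g h : nat -> R.

Lemma bernsteinD n g h :
  bernstein n (fun k => g k + h k) y = bernstein n g y + bernstein n h y.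
Proof. by elim: n g h => //= n IH g h; rewrite !(IH _, IH (g \o S)); ring. Qed.

Lemma bernsteinZ n a g : bernstein n (fun k => a * g k) y = a * bernstein n g y.
Proof. by elim: n g => //= n IH g; rewrite !(IH g, IH (g \o S)); ring. Qed.

Lemma bernstein_cst n a : bernstein n (fun=> a) y = a.
Proof. by elim: n => //= n IH; rewrite [(fun=> a) \o S]/comp IH; ring. Qed.

Lemma ler_bernstein n g h :
  (forall k, g k <= h k) -> bernstein n g y <= bernstein n h y.
Proof.
move: y01 => /andP[y0 y1].
elim: n g h => //= n IH g h gh.
by rewrite lerD// ler_wpM2l ?subr_ge0// IH//= => k; exact: gh.
Qed.

Lemma ler_norm_bernstein n g h :
  (forall k, `|g k| <= h k) -> `|bernstein n g y| <= bernstein n h y.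
Proof.
move=> gh; rewrite ler_norml -mulN1r -bernsteinZ.
by apply/andP; split; apply: ler_bernstein => k; have := gh k;
  rewrite ?mulN1r ler_norml => /andP[].
Qed.

(** Squared bias plus variance: the binomial law has mean [n y] and variance [n y (1 - y)]. The
    shift [a] is free because conditioning on a success turns it into [a + 1]. *)
Lemma bernstein_sqr n (a : R) :
  bernstein n (fun k => (k%:R + a) ^+ 2) y =
    (n%:R * y + a) ^+ 2 + n%:R * y * (1 - y).
Proof.
elim: n a => [|n IH] a /=; first by rewrite !mul0r addr0 add0r.
rewrite IH [_ \o S](_ : _ = fun k => (k%:R + (a + 1)) ^+ 2); last first.
  by apply/funext => k /=; rewrite -natr1; congr (_ ^+ 2); ring.
by rewrite IH -natr1; ring.
Qed.

End bernstein.

(** Bernstein's proof of the Weierstrass theorem. Chebyshev's inequality appears as the quadratic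
    majorant [h], valid for [k / n] near [y] by uniform continuity and far from [y] because [f] is
    bounded. *)
Lemma bernstein_approx (R : realType) (f : R -> R) (M e : R) :
  continuous f -> (forall x, `|f x| <= M) -> 0 < e ->
  exists n : nat, forall y, 0 <= y <= 1 ->
    `|bernstein n (fun k => f (k%:R / n%:R)) y - f y| <= e.
Proof.
move=> cf fM e0.
have M0 : 0 <= M by rewrite (le_trans _ (fM 0)).
have [|dl dl0 fdl] := @unif_continuous_segment R f 0 1 (e / 2) cf; first by rewrite divr_gt0.
(* The variance is bounded by [n], so the quadratic part of [h] has mean at most [2 M / (dl^2 n)],
   and this [n] makes it at most [e / 2]. *)
pose n := (Num.truncn (4 * M / (dl ^+ 2 * e))).+1.
have n0 : 0 < n%:R :> R by [].
exists n => y y01.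
rewrite -[f y](bernstein_cst y n) -mulN1r -bernsteinZ -bernsteinD.
pose h k : R := e / 2 + (2 * M / (dl ^+ 2 * n%:R ^+ 2)) * (k%:R + - (n%:R * y)) ^+ 2.
apply: (@le_trans _ _ (bernstein n h y)).
  apply: ler_norm_bernstein => // k; rewrite mulN1r.
  have c0 : 0 <= 2 * M / (dl ^+ 2 * n%:R ^+ 2).
    by rewrite divr_ge0 ?mulr_ge0 ?exprn_ge0// ltW.
  have [ky|ky] := ltP `|k%:R / n%:R - y| dl.
    apply: (le_trans (ltW (fdl _ _ y01 ky))).
    by rewrite /h lerDl mulr_ge0// sqr_ge0.
  apply: (@le_trans _ _ (2 * M)).
    by rewrite (le_trans (ler_normB _ _))// mulr2n mulrDl mul1r lerD.
  rewrite /h (@le_trans _ _ (2 * M / dl ^+ 2 * (k%:R / n%:R - y) ^+ 2))//.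
    rewrite mulrAC ler_pdivlMr ?exprn_gt0// ler_wpM2l ?mulr_ge0//.
    by rewrite -[leRHS]real_normK ?num_real// lerXn2r ?nnegrE// ltW.
  rewrite (_ : k%:R + - (n%:R * y) = n%:R * (k%:R / n%:R - y)); last first.
    by field; rewrite gt_eqF.
  rewrite exprMn [X in _ <= _ + X](_ : _ = 2 * M / dl ^+ 2 * (k%:R / n%:R - y) ^+ 2).
    by rewrite lerDr divr_ge0// ltW.
  by field; rewrite !gt_eqF.
rewrite bernsteinD bernstein_cst bernsteinZ bernstein_sqr.
have /andP[y0 y1] := y01.
rewrite subrr expr0n/= add0r [leRHS]splitr lerD2l.
apply: (@le_trans _ _ (2 * M / (dl ^+ 2 * n%:R))).
  rewrite [leRHS](_ : _ = 2 * M / (dl ^+ 2 * n%:R ^+ 2) * n%:R); last first.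
    by field; rewrite !gt_eqF.
  apply: ler_wpM2l; first by rewrite divr_ge0 ?mulr_ge0 ?exprn_ge0 ?(ltW dl0).
  by rewrite -mulrA ler_piMr// mulr_ile1 ?subr_ge0// lerBlDr lerDl.
rewrite ler_pdivrMr ?mulr_gt0 ?exprn_gt0//.
have : 4 * M / (dl ^+ 2 * e) <= n%:R.
  by apply/ltW; rewrite /n real_truncnS_gt ?num_real.
rewrite ler_pdivrMr ?mulr_gt0 ?exprn_gt0// => nM.
rewrite -(ler_pM2l (ltr0n R 2)) (_ : 2 * (2 * M) = 4 * M); last by ring.
by rewrite (le_trans nM)// le_eqVlt; apply/orP; left; apply/eqP; field.
Qed.

(** Phases cover the sines, frequency 0 the constants. Frequencies are arbitrary reals, so that any
    period can be chosen. *)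
Inductive trig_poly (R : realType) : (R -> R) -> Prop :=
| trig_poly_cos th al : trig_poly (fun x => cos (th * x + al))
| trig_polyD g h : trig_poly g -> trig_poly h -> trig_poly (fun x => g x + h x)
| trig_polyZ a g : trig_poly g -> trig_poly (fun x => a * g x).

(** On a cosine this is [2 sin A cos B = sin (A + B) + sin (A - B)], with each sine written as a
    cosine of phase [- pi / 2]. *)
Lemma trig_poly_sinM (R : realType) (c : R) (g : R -> R) :
  trig_poly g -> trig_poly (fun x => sin (c * x) * g x).
Proof.
elim=> {g} [th al|g h _ Hg _ Hh|a g _ Hg].
- rewrite (_ : (fun _ => _) = fun x => 2^-1 *
    (cos ((c + th) * x + (al - pi / 2)) + cos ((c - th) * x + (- al - pi / 2)))).
    by apply/trig_polyZ/trig_polyD; exact: trig_poly_cos.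
  apply/funext => x; rewrite !addrA !cosBpihalf.
  rewrite (_ : (c + th) * x + al = c * x + (th * x + al)); last by ring.
  rewrite (_ : (c - th) * x - al = c * x - (th * x + al)); last by ring.
  by rewrite sinD sinB; field.
- rewrite (_ : (fun _ => _) = fun x => sin (c * x) * g x + sin (c * x) * h x).
    exact: trig_polyD.
  by apply/funext => x; rewrite mulrDr.
- rewrite (_ : (fun _ => _) = fun x => a * (sin (c * x) * g x)).
    exact: trig_polyZ.
  by apply/funext => x; rewrite mulrCA.
Qed.

Lemma trig_poly_bernstein (R : realType) (c : R) n (g : nat -> R) :
  trig_poly (fun x => bernstein n g ((1 + sin (c * x)) / 2)).
Proof.
elim: n g => [|n IH] g /=.
  rewrite (_ : (fun _ => _) = fun x => g 0%N * cos (0 * x + 0)).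
    exact/trig_polyZ/trig_poly_cos.
  by apply/funext => x; rewrite mul0r addr0 cos0 mulr1.
set B := fun x => bernstein n g ((1 + sin (c * x)) / 2).
set C := fun x => bernstein n (g \o S) ((1 + sin (c * x)) / 2).
rewrite (_ : (fun _ => _) = fun x => 2^-1 * ((B x + C x) +
   ((-1) * (sin (c * x) * B x) + sin (c * x) * C x))); last first.
  by apply/funext => x; rewrite -/(B x) -/(C x); field.
apply/trig_polyZ/trig_polyD; first by apply: trig_polyD; exact: IH.
apply: trig_polyD; last by apply: trig_poly_sinM; exact: IH.
by apply/trig_polyZ/trig_poly_sinM; exact: IH.
Qed.

Lemma trig_poly_approx (R : realType) (f : R -> R) (M K e : R) :
  continuous f -> (forall x, `|f x| <= M) -> 0 < K -> 0 < e ->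
  exists g, [/\ trig_poly g, forall x, `|g x| <= M &
    forall x, `|x| <= K -> `|g x - f x| <= e].
Proof.
move=> cf fM K0 e0.
have pi40 : 0 < pi / 4 :> R by rewrite divr_gt0// pi_gt0.
have pi42 : pi / 4 < pi / 2 :> R.
  by rewrite ltr_pM2l ?pi_gt0// ltf_pV2 ?posrE// ltr_nat.
(* For [|x| <= K] the angle [c x] stays within [pi / 4], where the sine is injective and at most
   [s0 < 1] in absolute value, away from the end points of the domain of [asin]. *)
pose c : R := pi / 4 / K; pose s0 : R := sin (pi / 4).
have c0 : 0 < c by rewrite divr_gt0.
have in_pi2 (x : R) : `|x| <= pi / 4 -> x \in `[- (pi / 2), pi / 2].
  by rewrite in_itv/= ler_norml => /andP[? ?]; apply/andP; split; lra.
have s01 : s0 < 1.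
  rewrite -sin_pihalf ltr_sin// in_itv/= ?lexx ?andbT; last by lra.
  by apply/andP; split; lra.
have s00 : 0 <= s0.
  by rewrite /s0 sin_ge0_pi//; apply/andP; split; lra.
(* Projection onto [[- s0, s0]]: it makes [F] continuous on the whole line and changes nothing at
   the points that come from [|x| <= K]. *)
pose clamp : R -> R := cst (- s0) \max (cst s0 \min id).
have clampP s : -1 < clamp s < 1.
  rewrite /clamp/= lt_max gt_max gt_min s01/= andbT; apply/andP; split.
    by apply/orP; left; lra.
  by lra.
have cclamp : continuous clamp.
  move=> s; apply: continuous_max; first exact: cst_continuous.
  by apply: continuous_min; [exact: cst_continuous|exact: cvg_id].
pose F (y : R) : R := f (c^-1 * asin (clamp (2 * y - 1))).
have cF : continuous F.
  move=> y.
  have c1 : {for y, continuous (fun y : R => 2 * y - 1)}.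
    by apply: cvgB; [apply: cvgMl_tmp; exact: cvg_id|exact: cvg_cst].
  have c2 := continuous_comp c1 (cclamp _).
  have c3 := continuous_comp c2 (continuous_asin (clampP _)).
  have c4 : {for y, continuous (fun y : R => c^-1 * asin (clamp (2 * y - 1)))}.
    by apply: cvgMl_tmp; exact: c3.
  exact: continuous_comp c4 (cf _).
have FM y : `|F y| <= M by exact: fM.
have [n Hn] := bernstein_approx cF FM e0.
exists (fun x => bernstein n (fun k => F (k%:R / n%:R)) ((1 + sin (c * x)) / 2)).
have y01 (x : R) : 0 <= (1 + sin x) / 2 <= 1.
  have := sin_geN1 x; have := sin_le1 x => ? ?.
  by apply/andP; split; lra.
split.
- exact: trig_poly_bernstein.
- move=> x; rewrite -(bernstein_cst ((1 + sin (c * x)) / 2) n M).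
  exact: ler_norm_bernstein.
- move=> x xK; rewrite (_ : f x = F ((1 + sin (c * x)) / 2)); first exact: Hn.
  have cx : `|c * x| <= pi / 4.
    rewrite normrM gtr0_norm// /c mulrAC ler_pdivrMr//.
    by rewrite ler_wpM2l// ltW.
  rewrite /F (_ : _ - 1 = sin (c * x)); last by field.
  have [? ?] : - s0 <= sin (c * x) /\ sin (c * x) <= s0.
    have ler_sin : {in `[- (pi / 2), pi / 2] &, {mono @sin R : x y / x <= y}}.
      by apply: le_mono_in => u v uI vI; rewrite ltr_sin.
    move: (cx); rewrite ler_norml => /andP[cx1 cx2].
    by rewrite /s0 -sinN !ler_sin// in_pi2// ?normrN gtr0_norm.
  rewrite /clamp/= min_r// max_r// sinK ?in_pi2//.
  by rewrite mulKf// gt_eqF.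
Qed.

(** * Bounded functions and second moments *)

Section bounded_expectation.
Context (d : measure_display) (T : measurableType d) (R : realType).
Variable P : probability T R.

Lemma bounded_integrable (f : T -> R) (M : R) :
  measurable_fun setT f -> (forall w, `|f w| <= M) ->
  P.-integrable setT (EFin \o f).
Proof.
move=> mf fM; apply: measurable_bounded_integrable => //.
  by rewrite (le_lt_trans (probability_le1 P measurableT))// ltry.
exists M; split; first exact: num_real.
by move=> x Mx w _ /=; rewrite (le_trans (fM w))// ltW.
Qed.

Lemma Rintegral_probability_cst (r : R) : \int[P]_w r = r.
Proof.
have P1 := probability_setT P.
by rewrite Rintegral_cst// [X in fine X]P1 mulr1.
Qed.

Lemma integrable_sqr (X : T -> R) (C : R) : measurable_fun setT X ->
  (\int[P]_w (X w ^+ 2)%:E <= C%:E)%E ->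
  P.-integrable setT (fun w => (X w ^+ 2)%:E).
Proof.
move=> mX XC; apply/integrableP; split.
  by apply/measurable_EFinP; exact: measurable_funX.
under eq_integral => w _ do rewrite /= ger0_norm ?sqr_ge0//.
by rewrite (le_lt_trans XC)// ltry.
Qed.

(** Chebyshev's inequality in integrand form: where [|X| > K], the difference is at most
    [2 M <= 2 M X^2 / K^2], hence [e + 2 M X^2 / K^2] is a majorant everywhere. *)
Lemma expectation_close (X : T -> R) (f g : R -> R) (M C K e : R) :
  measurable_fun setT X -> (\int[P]_w (X w ^+ 2)%:E <= C%:E)%E ->
  measurable_fun setT f -> measurable_fun setT g ->
  (forall x, `|f x| <= M) -> (forall x, `|g x| <= M) ->
  0 < K -> 0 <= e -> (forall x, `|x| <= K -> `|g x - f x| <= e) ->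
  `|\int[P]_w g (X w) - \int[P]_w f (X w)| <= e + 2 * M / K ^+ 2 * C.
Proof.
move=> mX XC mf mg fM gM K0 e0 fge.
have M0 : 0 <= M by rewrite (le_trans _ (fM 0)).
have intf : P.-integrable setT (EFin \o (f \o X)).
  apply: (@bounded_integrable _ M); first exact: measurableT_comp.
  by move=> w; exact: fM.
have intg : P.-integrable setT (EFin \o (g \o X)).
  apply: (@bounded_integrable _ M); first exact: measurableT_comp.
  by move=> w; exact: gM.
have intX := integrable_sqr mX XC.
have intc (r : R) : P.-integrable setT (EFin \o cst r).
  exact: finite_measure_integrable_cst.
have intcX : P.-integrable setT (EFin \o (fun w => 2 * M / K ^+ 2 * X w ^+ 2)).
  by rewrite /comp; under eq_fun do rewrite EFinM; exact: integrableZl.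
rewrite -RintegralB//.
have intgf : P.-integrable setT (EFin \o (fun w => g (X w) - f (X w))).
  by rewrite /comp; under eq_fun do rewrite EFinB; exact: integrableB.
rewrite (le_trans (le_normr_Rintegral _ _))//.
apply: (@le_trans _ _ (\int[P]_w (e + 2 * M / K ^+ 2 * X w ^+ 2))).
  apply: le_Rintegral => //.
  - exact: integrable_norm.
  - rewrite /comp; under eq_fun do rewrite EFinD.
    exact: integrableD (intc e) intcX.
  move=> w _; have c0 : 0 <= 2 * M / K ^+ 2.
    by rewrite divr_ge0 ?mulr_ge0 ?exprn_ge0// ltW.
  have [XK|KX] := leP `|X w| K.
    by rewrite (le_trans (fge _ XK))// lerDl mulr_ge0// sqr_ge0.
  apply: (@le_trans _ _ (2 * M)).
    by rewrite (le_trans (ler_normB _ _))// mulr2n mulrDl mul1r lerD.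
  apply: (@le_trans _ _ (2 * M / K ^+ 2 * X w ^+ 2)); last by rewrite lerDr.
  rewrite mulrAC ler_pdivlMr ?exprn_gt0// ler_wpM2l ?mulr_ge0//.
  by rewrite -[leRHS]real_normK ?num_real// lerXn2r ?nnegrE// ltW.
rewrite RintegralD//; last exact: intc.
rewrite Rintegral_probability_cst lerD2l RintegralZl//.
apply: ler_wpM2l; first by rewrite divr_ge0 ?mulr_ge0 ?exprn_ge0// ltW.
rewrite -lee_fin fineK//; exact: integrable_fin_num.
Qed.

End bounded_expectation.

Lemma trig_poly_continuous (R : realType) (g : R -> R) : trig_poly g -> continuous g.
Proof.
elim=> {g} [th al|g h _ cg _ ch|a g _ cg] x.
- apply: (@continuous_comp _ _ _ (fun x : R => th * x + al) cos).
    by apply: cvgD; [apply: cvgMl_tmp; exact: cvg_id|exact: cvg_cst].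
  exact: continuous_cos.
- exact: cvgD (cg x) (ch x).
- exact: cvgMl_tmp (cg x).
Qed.

Lemma trig_poly_bounded (R : realType) (g : R -> R) :
  trig_poly g -> exists M, forall x, `|g x| <= M.
Proof.
elim=> {g} [th al|g h _ [M gM] _ [M' hM]|a g _ [M gM]].
- by exists 1 => x; exact: cos_max.
- by exists (M + M') => x; rewrite (le_trans (ler_normD _ _))// lerD.
- by exists (`|a| * M) => x; rewrite normrM ler_wpM2l.
Qed.

Section levy.
Context (d : measure_display) (T : measurableType d) (R : realType).
Context (d' : measure_display) (T' : measurableType d').
Variables (P : probability T R) (Q : probability T' R).
Variables (X : R -> T -> R) (Z : T' -> R) (C : R).
Hypothesis mX : \forall t \near +oo, measurable_fun setT (X t).
Hypothesis mZ : measurable_fun setT Z.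
Hypothesis X2 : \forall t \near +oo, (\int[P]_w (X t w ^+ 2)%:E <= C%:E)%E.
Hypothesis Z2 : (\int[Q]_w (Z w ^+ 2)%:E <= C%:E)%E.
Hypothesis cos_cvg : forall th al : R,
  \int[P]_w cos (th * X t w + al) @[t --> +oo] --> \int[Q]_w cos (th * Z w + al).

Lemma trig_poly_cvg (g : R -> R) : trig_poly g ->
  \int[P]_w g (X t w) @[t --> +oo] --> \int[Q]_w g (Z w).
Proof.
elim=> {g} [th al|g h tg cg th ch|a g tg cg]; first exact: cos_cvg.
- have [M gM] := trig_poly_bounded tg; have [M' hM] := trig_poly_bounded th.
  have mg := continuous_measurable_fun (trig_poly_continuous tg).
  have mh := continuous_measurable_fun (trig_poly_continuous th).
  rewrite RintegralD//; last 2 first.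
  - by apply: (@bounded_integrable _ _ _ _ _ M) => //; exact: measurableT_comp.
  - by apply: (@bounded_integrable _ _ _ _ _ M') => //; exact: measurableT_comp.
  apply: cvg_trans; last exact: cvgD cg ch.
  apply: near_eq_cvg; near=> t.
  have mXt : measurable_fun setT (X t) by near: t.
  rewrite /= [in RHS]RintegralD//.
  - by apply: (@bounded_integrable _ _ _ _ _ M) => //; exact: measurableT_comp.
  - by apply: (@bounded_integrable _ _ _ _ _ M') => //; exact: measurableT_comp.
- have [M gM] := trig_poly_bounded tg.
  have mg := continuous_measurable_fun (trig_poly_continuous tg).
  rewrite RintegralZl//; last first.
    by apply: (@bounded_integrable _ _ _ _ _ M) => //; exact: measurableT_comp.
  apply: cvg_trans; last exact: cvgMl_tmp cg.
  apply: near_eq_cvg; near=> t.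
  have mXt : measurable_fun setT (X t) by near: t.
  rewrite /= [in RHS]RintegralZl//.
  by apply: (@bounded_integrable _ _ _ _ _ M) => //; exact: measurableT_comp.
Unshelve. all: by end_near. Qed.

(** The common second moment bound [C] stands in for tightness: a trigonometric polynomial is close
    to [f] on [[- K, K]] only, and the rest of the line costs [2 M C / K^2] for [X t] and for [Z]
    alike. *)
Lemma bounded_continuous_cvg (f : R -> R) (M : R) :
  continuous f -> (forall x, `|f x| <= M) ->
  \int[P]_w f (X t w) @[t --> +oo] --> \int[Q]_w f (Z w).
Proof.
move=> cf fM; have mf := continuous_measurable_fun cf.
have M0 : 0 <= M by rewrite (le_trans _ (fM 0)).
have C0 : 0 <= C.
  rewrite -lee_fin (le_trans _ Z2)// integral_ge0// => w _.
  by rewrite lee_fin sqr_ge0.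
apply/cvgrPdist_le => e e0.
have e6 : 0 < e / 6 by rewrite divr_gt0.
(* This gives [2 M C <= K e / 6], and [K >= 1] lets [K ^+ 2] replace [K]; each use of the
   approximation then costs at most [e / 3]. *)
pose K := 1 + 2 * M * C / (e / 6).
have K1 : 1 <= K by rewrite lerDl divr_ge0 ?mulr_ge0// ltW.
have K0 : 0 < K by rewrite (lt_le_trans _ K1).
have [g [tg gM gf]] := trig_poly_approx cf fM K0 e6.
have mg := continuous_measurable_fun (trig_poly_continuous tg).
have eK : e / 6 + 2 * M / K ^+ 2 * C <= e / 3.
  rewrite (_ : e / 3 = e / 6 + e / 6); last by field.
  rewrite lerD2l mulrAC ler_pdivrMr ?exprn_gt0//.
  rewrite (@le_trans _ _ (e / 6 * K))//.
    rewrite mulrDr mulr1 mulrCA divff ?gt_eqF// mulr1 lerDr.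
    exact: ltW.
  by rewrite ler_pM2l// expr2 ler_peMr// ltW.
have /cvgrPdist_le/(_ (e / 3)) := trig_poly_cvg tg.
rewrite divr_gt0// => /(_ isT) cg.
near=> t.
have mXt : measurable_fun setT (X t) by near: t.
have X2t : (\int[P]_w (X t w ^+ 2)%:E <= C%:E)%E by near: t.
have cgt : `|\int[Q]_w g (Z w) - \int[P]_w g (X t w)| <= e / 3 by near: t.
have hP := expectation_close mXt X2t mf mg fM gM K0 (ltW e6) gf.
have hQ := expectation_close mZ Z2 mf mg fM gM K0 (ltW e6) gf.
have -> : e = e / 3 + e / 3 + e / 3 by field.
rewrite (le_trans (ler_distD (\int[P]_w g (X t w)) _ _))// lerD//; last first.
  exact: le_trans eK.
rewrite (le_trans (ler_distD (\int[Q]_w g (Z w)) _ _))// lerD// distrC.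
exact: le_trans eK.
Unshelve. all: by end_near. Qed.

End levy.

(** * The Gaussian law *)

Section gaussian_characteristic_function.
Variable R : realType.
Notation mu := (@lebesgue_measure R).

(** The integral over [[- n, n]] is [F n - F (- n)], and dominated convergence passes to the line.
    It serves as integration by parts against the Gaussian density. *)
Lemma integral_derive_eq0 (F f : R -> R) :
  (forall x, is_derive x (1 : R) F (f x)) -> continuous f ->
  mu.-integrable setT (EFin \o f) ->
  F n%:R @[n --> \oo] --> (0 : R) -> F (- n%:R) @[n --> \oo] --> (0 : R) ->
  (\int[mu]_x (f x)%:E = 0)%E.
Proof.
move=> dF cf intf Fy FNy.
have cF x : {for x, continuous F}.
  by apply/differentiable_continuous/derivable1_diffP; case: (dF x).
pose f_ n := EFin \o (f \_ `[- n%:R, n%:R]).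
have mf : measurable_fun setT f by exact: continuous_measurable_fun.
have mf_ n : measurable_fun setT (f_ n).
  apply/measurable_EFinP/(measurable_restrictT _ _).1 => //.
  exact: measurable_funS mf.
have [||||_ _] := @dominated_convergence _ _ _ mu setT measurableT f_
    (EFin \o f) (abse \o (EFin \o f)) mf_.
- exact/measurable_EFinP.
- apply: aeW => /= x _; apply: cvg_near_cst; near=> n.
  rewrite /f_ /= patchE mem_set//= in_itv/= -ler_norml.
  by near: n; exact: nbhs_infty_ger.
- exact: integrable_abse.
- apply: aeW => /= x n _; rewrite /f_ /= patchE.
  by case: ifPn; rewrite ?normr0 ?lee_fin.
rewrite /= => cvgf.
suff : (\int[mu]_x f_ n x)%E @[n --> \oo] --> 0%E.
  by move/cvg_lim => <- //; apply/esym/cvg_lim.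
have F0 : (F n%:R - F (- n%:R))%:E @[n --> \oo] --> (0 : R)%:E.
  by apply: cvg_EFin; [exact: nearW|rewrite -[X in _ --> X](subrr 0); exact: cvgB].
apply: cvg_trans F0; apply: near_eq_cvg; near=> n.
have n0 : - n%:R < n%:R :> R.
  by rewrite gtrN// ltr0n; near: n; exact: nbhs_infty_gt.
rewrite EFinB; have <- := @continuous_FTC2 R f F _ _ n0.
- by rewrite integral_mkcond; apply: eq_integral => x _; rewrite restrict_EFin.
- exact: continuous_subspaceT.
- split => [x _|/=|/=]; first by case: (dF x).
  + by apply: cvg_at_right_filter; exact: cF.
  + by apply: cvg_at_left_filter; exact: cF.
- by move=> x _; rewrite derive1E; case: (dF x).
Unshelve. all: by end_near. Qed.

Variable s : R.
Hypothesis s0 : 0 < s.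
Let p := normal_pdf 0 s.
Let sN0 : s != 0. Proof. by rewrite gt_eqF. Qed.

Let pE x : p x = normal_peak s * expR (- (x ^+ 2 / (s ^+ 2 *+ 2))).
Proof. by rewrite /p normal_pdfE// /normal_fun subr0 mulNr. Qed.

Let is_derive_p x : is_derive x (1 : R) p (- (x / s ^+ 2) * p x).
Proof.
have -> : p = fun x => normal_peak s * expR (- (x ^+ 2 / (s ^+ 2 *+ 2))).
  by apply/funext => y; rewrite pE.
pose q (x : R) := - (x ^+ 2 / (s ^+ 2 *+ 2)).
have dq : is_derive x (1 : R) q (- (x / s ^+ 2)).
  have -> : q = (- (s ^+ 2 *+ 2)^-1) \*: (@id R ^+ 2).
    by apply/funext => y; rewrite /q mulrC -mulNr.
  apply: is_derive_eq.
  rewrite [_ *: _](_ : _ = - (s ^+ 2 *+ 2)^-1 * (2 * x ^+ 1 * 1))//.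
  by rewrite -mulr_natr; field.
have de := @is_derive1_comp R expR q x _ _ (is_derive_expR _) dq.
apply: (is_derive_eq (is_deriveZ (normal_peak s) de)).
rewrite [LHS](_ : _ = normal_peak s * (expR (q x) * - (x / s ^+ 2)))//.
by rewrite /q; ring.
Qed.

Let p_ge0 x : 0 <= p x. Proof. exact: normal_pdf_ge0. Qed.

Let mp : measurable_fun setT p. Proof. exact: measurable_normal_pdf. Qed.

Let intp : mu.-integrable setT (EFin \o p). Proof. exact: integrable_normal_pdf. Qed.

(** With [y = x^2 / (4 s^2)] the density decays like [exp (- 2 y)]. The inequality [y <= exp y]
    spends one half of the exponent on the factor [x^2], and the other half is a Gaussian of
    deviation [sqrt 2 * s]; the constant adjusts the peaks. *)
Let sqr_p_le : exists2 C, 0 <= C & forall x, x ^+ 2 * p x <= C * normal_pdf 0 (Num.sqrt 2 * s) x.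
Proof.
have s2 : Num.sqrt 2 * s != 0 :> R by rewrite mulf_neq0// gt_eqF// sqrtr_gt0.
exists (4 * s ^+ 2 * normal_peak s / normal_peak (Num.sqrt 2 * s)).
  by rewrite divr_ge0 ?normal_peak_ge0// mulr_ge0 ?normal_peak_ge0// mulr_ge0 ?sqr_ge0.
move=> x; rewrite pE (normal_pdfE 0 s2) /normal_fun subr0 exprMn sqr_sqrtr//.
rewrite [leRHS]mulrA divfK; last by rewrite gt_eqF ?normal_peak_gt0.
rewrite mulNr.
rewrite mulrCA [leRHS](_ : _ = normal_peak s *
  (4 * s ^+ 2 * expR (- (x ^+ 2 / ((2 * s ^+ 2) *+ 2))))); last by ring.
rewrite ler_wpM2l ?normal_peak_ge0//.
set y := x ^+ 2 / ((2 * s ^+ 2) *+ 2).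
have s4 : 0 < 4 * s ^+ 2 by rewrite mulr_gt0// exprn_gt0.
have m2 (z : R) : z *+ 2 = 2 * z by rewrite mulr_natl.
rewrite (_ : x ^+ 2 / _ = y + y); last first.
  by rewrite /y (m2 (s ^+ 2)) (m2 (2 * s ^+ 2)); field.
rewrite opprD expRD mulrA ler_wpM2r ?expR_ge0//.
rewrite expRN ler_pdivrMr ?expR_gt0//.
rewrite (_ : x ^+ 2 = 4 * s ^+ 2 * y); last first.
  by rewrite /y (m2 (2 * s ^+ 2)); field.
rewrite ler_pM2l// (le_trans _ (expR_ge1Dx y))//.
by rewrite lerDr.
Qed.

Lemma integrable_normal_sqr : mu.-integrable setT (fun x => (x ^+ 2 * p x)%:E).
Proof.
have [C C0 sC] := sqr_p_le.
have intC : mu.-integrable setT (fun x => (C * normal_pdf 0 (Num.sqrt 2 * s) x)%:E).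
  by under eq_fun do rewrite EFinM; apply: integrableZl => //; exact: integrable_normal_pdf.
apply: le_integrable intC => //.
  by apply/measurable_EFinP/measurable_funM => //; exact: measurable_funX.
move=> x _; rewrite !lee_fin !ger0_norm//.
  by rewrite mulr_ge0// normal_pdf_ge0.
by rewrite mulr_ge0// sqr_ge0.
Qed.

(** As [|x| <= 1 + x^2], this also dominates [|x| * p x], which bounds the derivative of the
    integrand in [th] uniformly, as differentiation under the integral requires. *)
Let G x := (1 + x ^+ 2) * p x.

Let G_ge0 x : 0 <= G x. Proof. by rewrite mulr_ge0// addr_ge0// sqr_ge0. Qed.

Let intG : mu.-integrable setT (EFin \o G).
Proof.
rewrite (_ : _ \o _ = (fun x => (p x)%:E + (x ^+ 2 * p x)%:E)%E).
  by apply: integrableD => //; exact: integrable_normal_sqr.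
by apply/funext => x; rewrite /G /= -EFinD mulrDl mul1r.
Qed.

Let le_G x : `|x| * p x <= G x.
Proof.
rewrite ler_wpM2r// -(real_normK (num_real x)); have := normr_ge0 x.
by move: (`|x|) => y y0; nra.
Qed.

(** [(1 + x^2) * p x] is bounded, so at [x = n] and [x = - n] the decay is at least that of
    [1 / n.+1], since [n.+1 <= 1 + n^2]. *)
Let p_cvg0 (F : R -> R) : (forall x, `|F x| <= p x) ->
  F n%:R @[n --> \oo] --> (0 : R) /\ F (- n%:R) @[n --> \oo] --> (0 : R).
Proof.
move=> Fp; have [C C0 sC] := sqr_p_le.
have s2 : Num.sqrt 2 * s != 0 :> R by rewrite mulf_neq0// gt_eqF// sqrtr_gt0.
pose D := normal_peak s + C * normal_peak (Num.sqrt 2 * s).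
have GD x : G x <= D.
  rewrite /G mulrDl mul1r lerD//; first exact: normal_pdf_ub.
  by rewrite (le_trans (sC x))// ler_wpM2l// normal_pdf_ub.
have FD (x : R) (n : nat) : `|x| = n%:R -> `|F x| <= D * harmonic n.
  move=> xn; rewrite (le_trans (Fp x))// /harmonic ler_pdivlMr// mulrC.
  rewrite (le_trans _ (GD x))// ler_wpM2r// -natr1 addrC lerD2l.
  rewrite -(real_normK (num_real x)) xn -natrX ler_nat.
  by case: n {xn} => // n; rewrite expnS leq_pmulr// expn_gt0.
have D0 : D * harmonic n @[n --> \oo] --> (0 : R).
  by rewrite -[X in _ --> X](mulr0 D); apply: cvgMl_tmp; exact: cvg_harmonic.
by split; apply/norm_cvg0P; apply: (@squeeze_cvgr _ _ _ _ (cst 0) _ _ _ _ _ D0) => //;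
  [apply: nearW => n; rewrite normr_ge0 FD// ?normrN normr_nat|exact: cvg_cst
  |apply: nearW => n; rewrite normr_ge0 FD// ?normrN normr_nat|exact: cvg_cst].
Qed.

Section phase.
Variable al : R.

Let is_derive_affine th x :
  is_derive x (1 : R) (fun x : R => th * x + al) th.
Proof.
apply: (is_derive_eq (is_deriveD (is_deriveZ th (is_derive_id x (1 : R)))
  (is_derive_cst al x (1 : R)))).
by rewrite addr0 [LHS]mulr1.
Qed.

Let mtrig (th : R) : measurable_fun setT (fun x : R => cos (th * x + al)) /\
               measurable_fun setT (fun x : R => sin (th * x + al)).
Proof.
have c x : {for x, continuous (fun x : R => th * x + al)}.
  by apply: cvgD; [apply: cvgMl_tmp; exact: cvg_id|exact: cvg_cst].
by split; apply: continuous_measurable_fun => x; apply: continuous_comp (c x) _;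
  [exact: continuous_cos|exact: continuous_sin].
Qed.

Let intcos (th : R) : mu.-integrable setT (EFin \o (fun x : R => cos (th * x + al) * p x)).
Proof.
apply: le_integrable intp => //.
  by apply/measurable_EFinP/measurable_funM => //; exact: (mtrig th).1.
by move=> x _; rewrite lee_fin normrM ler_piMl// cos_max.
Qed.

Let intxsin (th : R) : mu.-integrable setT (EFin \o (fun x : R => x * sin (th * x + al) * p x)).
Proof.
apply: le_integrable intG => //.
  apply/measurable_EFinP/measurable_funM => //; apply: measurable_funM => //.
  exact: (mtrig th).2.
move=> x _; rewrite lee_fin (ger0_norm (G_ge0 x)) (le_trans _ (le_G x))//.
by rewrite !normrM (ger0_norm (p_ge0 x)) ler_wpM2r// ler_piMr// sin_max.
Qed.

Let c (th : R) := \int[mu]_x (cos (th * x + al) * p x).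

(** Gaussian integration by parts: [x * p x] is [- s^2] times the derivative of [p], and
    [sin (th x + al) * p x] vanishes at both ends. *)
Let parts (th : R) : \int[mu]_x (x * sin (th * x + al) * p x) = s ^+ 2 * th * c th.
Proof.
pose F (x : R) := sin (th * x + al) * p x.
pose f (x : R) := th * (cos (th * x + al) * p x) - (s ^+ 2)^-1 * (x * sin (th * x + al) * p x).
have dF x : is_derive x (1 : R) F (f x).
  have ds := @is_derive1_comp R sin _ x _ _ (is_derive_sin _) (is_derive_affine th x).
  apply: (is_derive_eq (is_deriveM ds (is_derive_p x))).
  rewrite [LHS](_ : _ = sin (th * x + al) * (- (x / s ^+ 2) * p x) +
    p x * (cos (th * x + al) * th))// /f; ring.
have cp : continuous p by exact: continuous_normal_pdf.
have cf : continuous f.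
  move=> x.
  have ca : {for x, continuous (fun x : R => th * x + al)}.
    by apply: cvgD; [apply: cvgMl_tmp; exact: cvg_id|exact: cvg_cst].
  have cc : {for x, continuous (fun x : R => cos (th * x + al))}.
    exact: (@continuous_comp R R R (fun x : R => th * x + al) cos x ca (@continuous_cos R (th * x + al))).
  have cs : {for x, continuous (fun x : R => sin (th * x + al))}.
    exact: (@continuous_comp R R R (fun x : R => th * x + al) sin x ca (@continuous_sin R (th * x + al))).
  apply: cvgB; apply: cvgMl_tmp; apply: cvgM; [exact: cc|exact: cp| |exact: cp].
  by apply: cvgM; [exact: cvg_id|exact: cs].
have i1 : mu.-integrable setT (EFin \o (fun x : R => th * (cos (th * x + al) * p x))).
  rewrite /comp; under eq_fun do rewrite EFinM; apply: integrableZl => //.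
  exact: intcos.
have i2 : mu.-integrable setT
    (EFin \o (fun x => (s ^+ 2)^-1 * (x * sin (th * x + al) * p x))).
  rewrite /comp; under eq_fun do rewrite EFinM; apply: integrableZl => //.
  exact: intxsin.
have intf : mu.-integrable setT (EFin \o f).
  by rewrite /f /comp; under eq_fun do rewrite EFinB; exact: integrableB.
have [F1 F2] : F n%:R @[n --> \oo] --> (0 : R) /\ F (- n%:R) @[n --> \oo] --> (0 : R).
  by apply: p_cvg0 => x; rewrite normrM (ger0_norm (p_ge0 x)) ler_piMl// sin_max.
have /(congr1 fine)/= := integral_derive_eq0 dF cf intf F1 F2.
rewrite -[LHS]/(\int[mu]_x f x) RintegralB// !RintegralZl//.
move=> /eqP; rewrite subr_eq0 => /eqP e.
by rewrite -mulrA -/(c th) e mulrA divff ?mul1r// sqrf_eq0.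
Qed.

(** Differentiating under the integral and then using [parts] gives a linear differential equation
    in [th]. *)
Let is_derive_c th : is_derive th (1 : R) c (- (s ^+ 2 * th * c th)).
Proof.
pose f (th x : R) := cos (th * x + al) * p x.
have df th' x : is_derive th' (1 : R) (f ^~ x) (- (x * sin (th' * x + al) * p x)).
  have da : is_derive th' (1 : R) (fun y : R => y * x + al) x.
    rewrite (_ : (fun _ => _) = fun y => x * y + al); last first.
      by apply/funext => y; rewrite mulrC.
    exact: is_derive_affine.
  have dc := @is_derive1_comp R cos _ th' _ _ (is_derive_cos _) da.
  apply: (is_derive_eq (is_deriveM dc (is_derive_cst (p x) th' (1 : R)))).
  rewrite [LHS](_ : _ = cos (th' * x + al) * 0 + p x * (- sin (th' * x + al) * x))//.
  by ring.
have Ia : `]th - 1, th + 1[%classic th by rewrite /= in_itv/=; apply/andP; split; lra.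
have h1 (x : R) : `]th - 1, th + 1[%classic x -> mu.-integrable setT (EFin \o f x).
  by move=> _; exact: intcos.
have h2 (x y : R) : `]th - 1, th + 1[%classic x -> setT y -> derivable (f ^~ y) x 1.
  by move=> _ _; case: (df x y).
have d1E x y : partial1of2 f x y = - (y * sin (x * y + al) * p y).
  by rewrite partial1of2E; case: (df x y).
have h3 (x y : R) : `]th - 1, th + 1[%classic x -> setT y -> `|partial1of2 f x y| <= G y.
  move=> _ _; rewrite d1E normrN (le_trans _ (le_G y))//.
  by rewrite !normrM (ger0_norm (p_ge0 y)) ler_wpM2r// ler_piMr// sin_max.
apply: DeriveDef.
  exact: (@derivable_under_integral _ _ _ mu f setT measurableT th _ _ Ia h1 h2 G G_ge0 intG h3).
rewrite -derive1E.
rewrite (@differentiation_under_integral _ _ _ mu f setT measurableT th _ _ Ia h1 h2 G G_ge0 intG h3).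
rewrite -parts -[RHS]mulN1r -(RintegralZl (-1) measurableT (intxsin th)).
by apply: eq_Rintegral => x _; rewrite d1E mulN1r.
Qed.

Lemma Rintegral_cos_normal_pdf th :
  \int[mu]_x (cos (th * x + al) * normal_pdf 0 s x) =
  expR (- ((s * th) ^+ 2 / 2)) * cos al.
Proof.
(* The exponential is the integrating factor of the equation [is_derive_c]. *)
pose h (t : R) := expR ((s * t) ^+ 2 / 2) * c t.
have dh t : is_derive t (1 : R) h 0.
  have dq : is_derive t (1 : R) (fun t : R => (s * t) ^+ 2 / 2) (s ^+ 2 * t).
    rewrite (_ : (fun _ => _) = (s ^+ 2 / 2) \*: (@id R ^+ 2)).
      apply: is_derive_eq.
      rewrite [LHS](_ : _ = (s ^+ 2 / 2) * (2 * t ^+ 1 * 1))//.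
      by field.
    by apply/funext => y /=; rewrite [RHS](_ : _ = (s ^+ 2 / 2) * y ^+ 2)//; field.
  have de := @is_derive1_comp R expR _ t _ _ (is_derive_expR _) dq.
  apply: (is_derive_eq (is_deriveM de (is_derive_c t))).
  rewrite [LHS](_ : _ = expR ((s * t) ^+ 2 / 2) * - (s ^+ 2 * t * c t) +
    c t * (expR ((s * t) ^+ 2 / 2) * (s ^+ 2 * t)))//.
  by ring.
have := is_derive_0_is_cst th 0 dh; rewrite /h.
rewrite mulr0 expr0n/= mul0r expR0 mul1r => hth.
have -> : cos al = c 0.
  rewrite /c; under eq_Rintegral do rewrite mul0r add0r.
  rewrite RintegralZl//.
  by rewrite /Rintegral integral_normal_pdf mulr1.
rewrite -hth mulrA -expRD addNr expR0 mul1r.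
by [].
Qed.

End phase.

End gaussian_characteristic_function.

(** The change of variables holds for the Radon-Nikodym derivative of [normal_prob], which agrees
    almost everywhere with the density as both have the same integrals over measurable sets. *)
Lemma ge0_integral_normal_prob (R : realType) (m s : R) (f : R -> \bar R) :
  measurable_fun setT f -> (forall x, 0 <= f x)%E ->
  (\int[normal_prob m s]_x f x =
   \int[lebesgue_measure]_x (f x * (normal_pdf m s x)%:E))%E.
Proof.
move=> mf f0; have dom := normal_prob_dominates m s.
rewrite -(Radon_Nikodym_SigmaFinite.change_of_variables dom)//.
apply: ae_eq_integral => //.
- apply: emeasurable_funM => //.
  exact: measurable_int (Radon_Nikodym_SigmaFinite.f_integrable dom).
- apply: emeasurable_funM => //; apply/measurable_EFinP.
  exact: measurable_normal_pdf.
apply: ae_eqe_mul2l; apply: integral_ae_eq => //.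
- exact: Radon_Nikodym_SigmaFinite.f_integrable.
- by apply/measurable_EFinP; exact: measurable_normal_pdf.
- by move=> A _ mA; rewrite -(Radon_Nikodym_SigmaFinite.f_integral dom).
Qed.

Lemma Rintegral_cos_normal_prob (R : realType) (s th al : R) : 0 < s ->
  \int[normal_prob 0 s]_x cos (th * x + al) = expR (- ((s * th) ^+ 2 / 2)) * cos al.
Proof.
move=> s0; rewrite -(Rintegral_cos_normal_pdf s0).
have mcos : measurable_fun setT (fun x : R => cos (th * x + al)).
  apply: (measurableT_comp (continuous_measurable_fun (@continuous_cos R))).
  by apply: measurable_funD => //; exact: measurable_funM.
have intcos : (normal_prob 0 s).-integrable setT (EFin \o (fun x => cos (th * x + al))).
  by apply: (@bounded_integrable _ _ _ _ _ 1) => // w; exact: cos_max.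
have int1 : (normal_prob 0 s).-integrable setT (EFin \o (fun=> 1)).
  exact: finite_measure_integrable_cst.
(* Adding 1 makes the cosine nonnegative, so that [ge0_integral_normal_prob] applies. *)
have e1 := RintegralD measurableT int1 intcos.
rewrite Rintegral_probability_cst in e1.
apply: (addrI 1); rewrite -e1 /Rintegral ge0_integral_normal_prob/=.
3: by move=> x; rewrite lee_fin/= -lerBlDl sub0r cos_geN1.
2: by apply/measurable_EFinP; exact: measurable_funD.
have intp := integrable_normal_pdf (0 : R) s.
have intcp : lebesgue_measure.-integrable setT
    (fun x : R => (cos (th * x + al) * normal_pdf 0 s x)%:E).
  apply: le_integrable intp => //.
    by apply/measurable_EFinP/measurable_funM => //; exact: measurable_normal_pdf.
  by move=> x _; rewrite lee_fin normrM ler_piMl// cos_max.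
under eq_integral do rewrite -EFinM mulrDl mul1r EFinD.
rewrite integralD// integral_normal_pdf fineD//.
exact: integrable_fin_num.
Qed.

Lemma normal_prob_sqr_lty (R : realType) (s : R) : 0 < s ->
  (\int[normal_prob 0 s]_x (x ^+ 2)%:E < +oo)%E.
Proof.
move=> s0; rewrite ge0_integral_normal_prob; last 2 first.
- by apply/measurable_EFinP; exact: measurable_funX.
- by move=> x; rewrite lee_fin sqr_ge0.
have /integrable_lty := integrable_normal_sqr s0.
by apply; exact: measurableT.
Qed.

(** * Wiener-Ito integrals *)

Section square_integrable.
Context (d : measure_display) (T : measurableType d) (R : realType).
Variable mu : {measure set T -> \bar R}.
Implicit Types f g : T -> R.

Lemma Lnorm2_sqr f :
  ('N[mu]_2%:E[EFin \o f] `^ 2 = \int[mu]_x (f x ^+ 2)%:E)%E.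
Proof.
rewrite powR_Lnorm//; apply: eq_integral => x _.
by rewrite /= powR_mulrn// real_normK// num_real.
Qed.

Lemma Lfun2P f : f \in Lfun mu 2%:E <->
  measurable_fun setT f /\ (\int[mu]_x (f x ^+ 2)%:E < +oo)%E.
Proof.
split=> [/[dup] f2|[mf f2]].
  rewrite inE => /andP[/[!inE]/= mf _]; split => //.
  by have /integrable_lty := Lfun2_integrable_sqr f2; apply.
apply/andP; split; rewrite inE//= /finite_norm.
by apply: (@lty_poweRy _ _ 2) => //; rewrite Lnorm2_sqr.
Qed.

Lemma Lfun_cst0 : (fun=> 0) \in Lfun mu 2%:E.
Proof. by apply/Lfun2P; split => //; rewrite integral0_eq// => z _; rewrite expr0n. Qed.

Lemma integrableM_Lfun2 f g : f \in Lfun mu 2%:E -> g \in Lfun mu 2%:E ->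
  mu.-integrable setT (fun x => (f x * g x)%:E).
Proof.
by move=> f2 g2; apply/Lfun1_integrable; exact: Lfun2_mul_Lfun1.
Qed.

Lemma Lfun2D (a : R) f g : f \in Lfun mu 2%:E -> g \in Lfun mu 2%:E ->
  (fun x => a * f x + g x) \in Lfun mu 2%:E.
Proof.
move=> /[dup] f2 /Lfun2P[mf _] /[dup] g2 /Lfun2P[mg _]; apply/Lfun2P; split.
  by apply: measurable_funD => //; exact: measurable_funM.
have := integrableD measurableT (integrableZl measurableT (2 * a ^+ 2)
  (Lfun2_integrable_sqr f2)) (integrableZl measurableT 2 (Lfun2_integrable_sqr g2)).
move/integrable_lty => /(_ measurableT); apply: le_lt_trans.
apply: ge0_le_integral => //=.
- by move=> x _; rewrite lee_fin sqr_ge0.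
- apply/measurable_EFinP/measurable_funX/measurable_funD => //.
  exact: measurable_funM.
- apply: emeasurable_funD.
  + by apply/measurable_EFinP/measurable_funM => //; exact: measurable_funX.
  + by apply/measurable_EFinP/measurable_funM => //; exact: measurable_funX.
- move=> x _; rewrite -!EFinM -EFinD lee_fin -subr_ge0.
  rewrite (_ : _ - _ = (a * f x - g x) ^+ 2); last by ring.
  exact: sqr_ge0.
Qed.

Lemma RintegralX_lin (a b : R) f g : f \in Lfun mu 2%:E -> g \in Lfun mu 2%:E ->
  \int[mu]_x (a * f x + b * g x) ^+ 2 =
  a ^+ 2 * (\int[mu]_x (f x ^+ 2)) + 2 * a * b * (\int[mu]_x (f x * g x))
   + b ^+ 2 * (\int[mu]_x (g x ^+ 2)).
Proof.
move=> f2 g2.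
have i1 := integrableZl measurableT (a ^+ 2) (Lfun2_integrable_sqr f2).
have i2 := integrableZl measurableT (2 * a * b) (integrableM_Lfun2 f2 g2).
have i3 := integrableZl measurableT (b ^+ 2) (Lfun2_integrable_sqr g2).
rewrite -!RintegralZl//;
  [|exact: Lfun2_integrable_sqr|exact: integrableM_Lfun2|exact: Lfun2_integrable_sqr].
rewrite -!RintegralD//; first by apply: eq_Rintegral => x _; ring.
exact: (integrableD measurableT i1 i2).
Qed.

End square_integrable.

Section wiener_ito.
Context (dZ d : measure_display) (Z : measurableType dZ)
  (Omega : measurableType d) (R : realType).
Variables (mu : {measure set Z -> \bar R}) (P : probability Omega R).
Variables (N : set Z -> {RV P >-> R}) (J : (Z -> R) -> Omega -> R).
Hypothesis HJ : wiener_ito_integral mu N J.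
Implicit Types f g : Z -> R.

Lemma wiener_ito_Lfun f : f \in Lfun mu 2%:E -> J f \in Lfun P 2%:E.
Proof. by case: HJ => + _ _ _; exact. Qed.

Lemma wiener_ito_lin (a : R) f g : f \in Lfun mu 2%:E -> g \in Lfun mu 2%:E ->
  {ae P, forall w, J (fun z => a * f z + g z) w = a * J f w + J g w}.
Proof. by case: HJ => _ + _ _; exact. Qed.

Lemma wiener_ito_sqr f : f \in Lfun mu 2%:E ->
  (\int[P]_w (J f w ^+ 2)%:E = \int[mu]_z (f z ^+ 2)%:E)%E.
Proof.
by case: HJ => _ _ iso _ f2; rewrite -!Lnorm2_sqr iso.
Qed.

Lemma wiener_ito_indic B : measurable B -> (mu B < +oo)%E ->
  {ae P, forall w, J (\1_B) w = N B w}.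
Proof. by case: HJ => _ _ _ +; exact. Qed.

Lemma wiener_ito_sqrB f g : f \in Lfun mu 2%:E -> g \in Lfun mu 2%:E ->
  (\int[P]_w ((J f w - J g w) ^+ 2)%:E = \int[mu]_z ((f z - g z) ^+ 2)%:E)%E.
Proof.
move=> f2 g2.
have fg2 : (fun z => -1 * g z + f z) \in Lfun mu 2%:E by exact: Lfun2D.
rewrite (_ : (fun z => ((f z - g z) ^+ 2)%:E) =
             fun z => ((-1 * g z + f z) ^+ 2)%:E); last first.
  by apply/funext => z; congr (_ ^+ 2)%:E; ring.
rewrite -(wiener_ito_sqr fg2).
have [mf _] := (Lfun2P P (J f)).1 (wiener_ito_Lfun f2).
have [mg _] := (Lfun2P P (J g)).1 (wiener_ito_Lfun g2).
have [mfg _] := (Lfun2P P _).1 (wiener_ito_Lfun fg2).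
apply: ae_eq_integral => //.
- by apply/measurable_EFinP/measurable_funX/measurable_funB.
- by apply/measurable_EFinP/measurable_funX.
- have := wiener_ito_lin (-1) g2 f2; apply: filterS => w -> _.
  by congr (_ ^+ 2)%:E; ring.
Qed.

(** Polarization: both sides of [wiener_ito_sqrB] are expanded, and the squares agree by the
    isometry. *)
Lemma wiener_ito_inner f g : f \in Lfun mu 2%:E -> g \in Lfun mu 2%:E ->
  \int[P]_w (J f w * J g w) = \int[mu]_z (f z * g z).
Proof.
move=> f2 g2; have Jf2 := wiener_ito_Lfun f2; have Jg2 := wiener_ito_Lfun g2.
have := congr1 fine (wiener_ito_sqrB f2 g2).
rewrite -[LHS]/(\int[P]_w (J f w - J g w) ^+ 2).
rewrite -[RHS]/(\int[mu]_z (f z - g z) ^+ 2).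
have e (x y : R) : x - y = 1 * x + (-1) * y by ring.
under eq_Rintegral do rewrite e.
under [RHS]eq_Rintegral do rewrite e.
rewrite !RintegralX_lin//.
have -> : \int[P]_w (J f w ^+ 2) = \int[mu]_z (f z ^+ 2).
  by rewrite /Rintegral wiener_ito_sqr.
have -> : \int[P]_w (J g w ^+ 2) = \int[mu]_z (g z ^+ 2).
  by rewrite /Rintegral wiener_ito_sqr.
by lra.
Qed.

Lemma indic_Lfun2 B : measurable B -> (mu B < +oo)%E -> \1_B \in Lfun mu 2%:E.
Proof.
move=> mB Boo; apply/Lfun2P; split; first exact: measurable_indic.
rewrite (eq_integral (fun z => (\1_B z)%:E)).
  by rewrite integral_indic// setIT.
by move=> z _; rewrite indicE; case: (_ \in _); rewrite ?expr1n ?expr0n.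
Qed.

Lemma wiener_ito0 : {ae P, forall w, J (fun=> 0) w = 0}.
Proof.
have := wiener_ito_lin 1 (Lfun_cst0 mu) (Lfun_cst0 mu).
rewrite (_ : (fun z => _) = (fun=> 0)); first by apply: filterS => w; lra.
by apply/funext => z; rewrite mulr0 addr0.
Qed.

Lemma wiener_ito_indic_sum (c : nat -> R) (B : nat -> set Z) n :
  (forall i, measurable (B i)) -> (forall i, mu (B i) < +oo)%E ->
  (fun z => \sum_(i < n) c i * \1_(B i) z) \in Lfun mu 2%:E /\
  {ae P, forall w, J (fun z => \sum_(i < n) c i * \1_(B i) z) w =
                   \sum_(i < n) c i * N (B i) w}.
Proof.
move=> mB Boo; elim: n => [|n [IH1 IH2]].
  rewrite (_ : (fun z => _) = (fun=> 0)); last first.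
    by apply/funext => z; rewrite big_ord0.
  split; first exact: Lfun_cst0.
  by apply: filterS wiener_ito0 => w ->; rewrite big_ord0.
have e : (fun z => \sum_(i < n.+1) c i * \1_(B i) z) =
         (fun z => c n * \1_(B n) z + \sum_(i < n) c i * \1_(B i) z).
  by apply/funext => z; rewrite big_ord_recr/= addrC.
have B2 := indic_Lfun2 (mB n) (Boo n); rewrite e; split; first exact: Lfun2D.
have h1 := wiener_ito_lin (c n) B2 IH1; have h2 := wiener_ito_indic (mB n) (Boo n).
apply: filterS3 h1 h2 IH2 => w -> -> ->.
by rewrite big_ord_recr/= addrC.
Qed.

Lemma compensated_poissonU B C : measurable B -> measurable C ->
  (mu B < +oo)%E -> (mu C < +oo)%E -> B `&` C = set0 ->
  {ae P, forall w, N (B `|` C) w = N B w + N C w}.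
Proof.
move=> mB mC Boo Coo BC.
have mBC : measurable (B `|` C) by exact: measurableU.
have BCoo : (mu (B `|` C) < +oo)%E.
  by rewrite measureU// lte_add_pinfty.
have h1 := wiener_ito_lin 1 (indic_Lfun2 mB Boo) (indic_Lfun2 mC Coo).
have e : (fun z => 1 * \1_B z + \1_C z) = \1_(B `|` C) :> (Z -> R).
  apply/funext => z; rewrite mul1r !indicE in_setU.
  have [zB|zB] := boolP (z \in B); have [zC|zC] := boolP (z \in C);
    rewrite ?addr0 ?add0r//.
  by have := in_setI z B C; rewrite BC in_set0 zB zC.
rewrite e in h1.
have h2 := wiener_ito_indic mB Boo; have h3 := wiener_ito_indic mC Coo.
have h4 := wiener_ito_indic mBC BCoo.
apply: filterS3 (filterI h1 h4) h2 h3 => w [/[swap] <- ->] -> ->.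
by rewrite mul1r.
Qed.

End wiener_ito.

(** * Poisson sums *)

Section poisson_void_probability.
Context (dZ d : measure_display) (Z : measurableType dZ)
  (Omega : measurableType d) (R : realType).
Variables (mu : {measure set Z -> \bar R}) (P : probability Omega R).
Variables (N : set Z -> {RV P >-> R}).
Hypothesis HN : compensated_poisson_measure mu N.
Variable B : set Z.
Hypotheses (mB : measurable B) (Boo : (mu B < +oo)%E).
Let m := fine (mu B).

Let m_ge0 : 0 <= m. Proof. exact: fine_ge0. Qed.

Lemma compensated_poisson_law (A : set R) : measurable A ->
  P (N B @^-1` A) = poisson_prob m 0%N ((fun k : nat => k%:R - m) @^-1` A).
Proof. by case: HN => _ + mA => /(_ B mB Boo A mA). Qed.

Lemma poisson_prob_set1 (k : nat) :
  poisson_prob m 0%N [set k] = ((m ^+ k) * k`!%:R^-1 * expR (- m))%:E.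
Proof.
rewrite /poisson_prob; case: ltP => [m0|m0].
  by rewrite esum_set1 /poisson_pmf ?m0// lee_fin !mulr_ge0 ?expR_ge0 ?exprn_ge0.
have -> : m = 0 by apply/eqP; rewrite eq_le m0 m_ge0.
rewrite oppr0 expR0 mulr1 diracE; case: k => [|k].
  by rewrite mem_set// expr0 fact0 invr1 mulr1.
by rewrite expr0n mul0r memNset.
Qed.

Lemma compensated_poisson_void :
  P (N B @^-1` [set - m]) = (expR (- m))%:E.
Proof.
rewrite compensated_poisson_law// (_ : _ @^-1` _ = [set 0%N]).
  by rewrite poisson_prob_set1 expr0 fact0 invr1 !mul1r.
apply/seteqP; split=> k /=; last by move=> ->; rewrite add0r.
by move=> /eqP; rewrite -subr_eq0 opprK subrK pnatr_eq0 => /eqP.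
Qed.

Lemma compensated_poisson_ge : {ae P, forall w, (- m <= N B w)%R}.
Proof.
exists (N B @^-1` (`]-oo, (- m)%R[%classic : set R)); split.
- exact: measurable_funPTI.
- rewrite compensated_poisson_law// (_ : _ @^-1` _ = set0) ?measure0//.
  apply/seteqP; split=> // k /=; rewrite in_itv/=.
  by rewrite -subr_lt0 opprK subrK ltrn0.
- by move=> w /= /negP; rewrite -ltNge in_itv.
Qed.

(** A Poisson count is at least 2 with probability [1 - (1 + m) exp (- m)], at most
    [1 - (1 + m) (1 - m)]. *)
Lemma compensated_poisson_ge2 :
  (P (N B @^-1` ~` [set (- m)%R; (1 - m)%R]) <= (m ^+ 2)%:E)%E.
Proof.
have mA : measurable [set - m; 1 - m] by exact: measurableU.
rewrite compensated_poisson_law; last exact: measurableC.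
rewrite (_ : _ @^-1` _ = ~` [set 0%N; 1%N]); last first.
  rewrite -preimage_setC; congr (~` _); apply/seteqP; split=> k /=.
    move=> [] /eqP; rewrite -subr_eq0.
      by rewrite opprK subrK pnatr_eq0 => /eqP; left.
    by rewrite opprB addrA subrK subr_eq0 (eqr_nat _ k 1) => /eqP; right.
  by move=> [->|->]; [left; rewrite add0r|right].
rewrite probability_setC//.
have e01 : poisson_prob m 0%N [set 0%N; 1%N] = (expR (- m) + m * expR (- m))%:E.
  rewrite measureU//; last by apply/seteqP; split => // k /= [-> ].
  rewrite [X in (X + _)%E]poisson_prob_set1 [X in (_ + X)%E]poisson_prob_set1.
  by rewrite expr0 fact0 invr1 expr1 !mul1r mulr1.
rewrite [X in (1 - X)%E]e01 -EFinB lee_fin; have /andP[] := expRN_bounds m_ge0.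
move=> mE _; have : (1 - m) * (1 + m) <= expR (- m) * (1 + m).
  by rewrite ler_wpM2r// addr_ge0.
by rewrite (_ : (1 - m) * (1 + m) = 1 - m ^+ 2); [lra|ring].
Qed.

End poisson_void_probability.

(* [indicator_cos c m n a] is the mean of [cos (a + \sum_(i < n) c i * eta i)]
   for independent indicators [eta i] that vanish with probability
   [expR (- m i)]. *)
Fixpoint indicator_cos (R : realType) (c m : nat -> R) (n : nat) (a : R) : R :=
  if n is k.+1 then
    expR (- m k) * indicator_cos c m k a
      + (1 - expR (- m k)) * indicator_cos c m k (a + c k)
  else cos a.

(** The indicators are exchanged for Gaussian factors one at a time, as in Lindeberg's method. The
    error is a convex combination of two instances of the induction hypothesis with shifted phases,
    plus the error of [cos_poisson_step] multiplied by a Gaussian factor at most 1. *)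
Lemma indicator_cos_gauss (R : realType) (c m : nat -> R) n a :
  (forall i, 0 <= m i) ->
  `|indicator_cos c m n (a - \sum_(i < n) c i * m i)
    - expR (- (\sum_(i < n) c i ^+ 2 * m i / 2)) * cos a|
  <= \sum_(i < n) (`|c i| ^+ 3 * m i + m i ^+ 2 * (1 + `|c i|) ^+ 4).
Proof.
move=> m0; elim: n a => [|n IH] a.
  by rewrite !big_ord0 subr0 oppr0 expR0 mul1r subrr normr0.
rewrite !big_ord_recr /=.
set S := \sum_(i < n) c i * m i; set V := \sum_(i < n) _ / 2.
set D := \sum_(i < n) (_ + _).
set b := c n; set e := m n; set E := expR (- e).
have E0 : 0 <= E by exact: expR_ge0.
have E1 : 0 <= 1 - E by rewrite subr_ge0 -expR0 ler_expR oppr_le0 m0.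
have V0 : 0 <= expR (- V) <= 1.
  rewrite expR_ge0/= -expR0 ler_expR oppr_le0 sumr_ge0// => i _.
  by rewrite divr_ge0// mulr_ge0// sqr_ge0.
have h1 := IH (a - b * e); have h2 := IH (a + b - b * e).
have h3 := cos_poisson_step a b (m0 n : 0 <= e).
rewrite -/S -/V -/D -/E in h1 h2 h3 *.
rewrite (_ : a - (S + b * e) = a - b * e - S); last by ring.
rewrite (_ : a - b * e - S + b = a + b - b * e - S); last by ring.
rewrite opprD expRD.
move: h1 h2 h3 V0; set x := indicator_cos _ _ _ _; set y := indicator_cos _ _ _ _.
set C1 := cos _; set C2 := cos _; set C0 := cos a; set v := expR (- V).
set v' := expR (- (b ^+ 2 * e / 2)) => h1 h2 h3 /andP[v0 v1].
rewrite (_ : _ - _ = E * (x - v * C1) + (1 - E) * (y - v * C2)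
  + v * (E * C1 + (1 - E) * C2 - v' * C0)); last by ring.
apply: (le_trans (ler_normD _ _)); apply: lerD.
  apply: (le_trans (ler_normD _ _)).
  rewrite !normrM (ger0_norm E0) (ger0_norm E1).
  apply: (@le_trans _ _ (E * D + (1 - E) * D)); last by rewrite -mulrDl subrKC mul1r.
  by rewrite lerD// ler_wpM2l.
by rewrite normrM (ger0_norm v0) (le_trans _ h3)// ler_piMl.
Qed.

Section poisson_sum.
Context (dZ d : measure_display) (Z : measurableType dZ)
  (Omega : measurableType d) (R : realType).
Variables (mu : {measure set Z -> \bar R}) (P : probability Omega R).
Variables (N : set Z -> {RV P >-> R}) (J : (Z -> R) -> Omega -> R).
Hypothesis HN : compensated_poisson_measure mu N.
Hypothesis HJ : wiener_ito_integral mu N J.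

(** In terms of the Poisson count [N A + mu A], this is the event that no point falls in [A]. *)
Let void (A : set Z) : Omega -> R := \1_(N A @^-1` [set - fine (mu A)]).

Let mvoid A : measurable_fun setT (void A).
Proof. by apply: measurable_indic; exact: measurable_funPTI. Qed.

Let voidP A w : void A w = 0 \/ void A w = 1.
Proof. by rewrite /void indicE; case: (_ \in _); [right|left]. Qed.

Let voidU A C : measurable A -> measurable C -> (mu A < +oo)%E ->
  (mu C < +oo)%E -> A `&` C = set0 ->
  {ae P, forall w, void (A `|` C) w = void A w * void C w}.
Proof.
move=> mA mC Aoo Coo AC.
have h1 := compensated_poissonU HJ mA mC Aoo Coo AC.
have h2 := compensated_poisson_ge HN mA Aoo.
have h3 := compensated_poisson_ge HN mC Coo.
apply: filterS3 h1 h2 h3 => w NU NA NC.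
rewrite /void measureU// fineD ?ge0_fin_numE// !indicE.
have [|] := boolP (w \in _); rewrite ?inE ?notin_setE /= NU => NAC.
  rewrite !mem_set ?mulr1//=; lra.
have [|_] := boolP (w \in _); last by rewrite mul0r.
rewrite inE /= => NA'; rewrite memNset ?mulr0//= => NC'; apply: NAC.
by rewrite NA' NC' opprD.
Qed.

Variables (c : nat -> R) (B : nat -> set Z).
Hypotheses (mB : forall i, measurable (B i)) (Boo : forall i, (mu (B i) < +oo)%E).
Hypothesis tB : trivIset setT B.
Let m i := fine (mu (B i)).
Let S n w := \sum_(i < n) c i * (1 - void (B i) w).

Let mS n : measurable_fun setT (S n).
Proof.
apply: measurable_sum => i; apply: measurable_funM => //.
exact: measurable_funB.
Qed.

Let mcosS n a : measurable_fun setT (fun w => cos (S n w + a)).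
Proof.
apply: (measurableT_comp (continuous_measurable_fun (@continuous_cos R))).
exact: measurable_funD.
Qed.

Let intcosv n a A : P.-integrable setT (EFin \o (fun w => cos (S n w + a) * void A w)).
Proof.
apply: (@bounded_integrable _ _ _ _ _ 1); first exact: measurable_funM.
move=> w; rewrite normrM; case: (voidP A w) => ->.
  by rewrite normr0 mulr0.
by rewrite normr1 mulr1 cos_max.
Qed.

(** The extra factor [void C] makes the induction possible. Distinguishing the two values of
    [void (B n)] splits the integrand into terms with [void C] and terms with [void (B n) * void C].
    The latter product is [void] of the union, so every term has the same shape with [n] pieces, and
    the void probability of a union factorizes. *)
Let cosS_void n a C : measurable C -> (mu C < +oo)%E ->
  (forall i, (i < n)%N -> B i `&` C = set0) ->
  \int[P]_w (cos (S n w + a) * void C w) =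
  expR (- fine (mu C)) * indicator_cos c m n a.
Proof.
elim: n a C => [|n IH] a C mC Coo BC.
  rewrite /S; under eq_Rintegral do rewrite big_ord0 add0r.
  rewrite RintegralZl//; last first.
    by apply: (@bounded_integrable _ _ _ _ _ 1) => // w; case: (voidP C w) => ->;
      rewrite ?normr0 ?normr1.
  rewrite /void /Rintegral integral_indic//.
  by rewrite setIT [X in _ * fine X = _](compensated_poisson_void HN mC Coo) mulrC.
have BCn : B n `&` C = set0 by exact: BC.
have mU : measurable (B n `|` C) by exact: measurableU.
have Uoo : (mu (B n `|` C) < +oo)%E by rewrite measureU ?lte_add_pinfty ?Boo.
have fU : fine (mu (B n `|` C)) = m n + fine (mu C).
  by rewrite measureU// fineD// ge0_fin_numE ?Boo.
have dU i : (i < n)%N -> B i `&` (B n `|` C) = set0.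
  move=> ni; rewrite setIUr BC ?setU0; last by rewrite ltnW.
  by move/trivIsetP : tB; apply => //; rewrite ltn_eqF.
have dC i : (i < n)%N -> B i `&` C = set0 by move=> ni; apply: BC; exact: ltnW.
transitivity (\int[P]_w (cos (S n w + a) * void (B n `|` C) w +
    (cos (S n w + (a + c n)) * void C w - cos (S n w + (a + c n)) * void (B n `|` C) w))).
  congr fine; apply: ae_eq_integral => //.
  - by apply/measurable_EFinP; apply: measurable_funM.
  - apply/measurable_EFinP; apply: measurable_funD; first exact: measurable_funM.
    by apply: measurable_funB; exact: measurable_funM.
  - apply: filterS (voidU (mB n) mC (Boo n) Coo BCn) => w -> _; congr EFin.
    rewrite /S big_ord_recr /= -/(S n w).
    case: (voidP (B n) w) => ->.
      by rewrite subr0 mulr1 mul0r !mulr0 add0r subr0 -addrA [c n + a]addrC.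
    by rewrite subrr mulr0 addr0 mul1r subrr addr0.
rewrite RintegralD//; last first.
  by rewrite /comp; under eq_fun do rewrite EFinB; apply: integrableB => //; exact: intcosv.
rewrite RintegralB//.
rewrite !IH// fU opprD expRD /=.
by ring.
Qed.

Let cosS_mean n a : \int[P]_w cos (S n w + a) = indicator_cos c m n a.
Proof.
(* The mean without void factor is the case [C = set0] of [cosS_void]. *)
have v0 : {ae P, forall w, void set0 w = 1}.
  have := compensated_poisson_void HN measurable0.
  rewrite measure0 => /(_ (ltry _)); rewrite /= oppr0 expR0 => N0.
  have : {ae P, forall w, (N set0 @^-1` [set 0]) w}.
    exists (~` (N set0 @^-1` [set 0])); split => //.
      by apply: measurableC; exact: measurable_funPTI.
    rewrite probability_setC; last exact: measurable_funPTI.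
    by rewrite [X in (1 - X)%E]N0 subee.
  apply: filterS => w N0w; rewrite /void indicE measure0 /= oppr0 mem_set//.
have := @cosS_void n a set0 measurable0.
rewrite measure0 /= oppr0 expR0 mul1r => <- //; last by move=> i _; rewrite setI0.
congr fine; apply: ae_eq_integral => //.
- exact/measurable_EFinP.
- by apply/measurable_EFinP; apply: measurable_funM.
- by apply: filterS v0 => w -> _; rewrite mulr1.
Qed.

(** Outside [D i] the count [N (B i) + m i] is 0 or 1 and equals [1 - void (B i)]. Each [D i] has
    probability at most [m i ^+ 2], and on it two cosines differ by at most 2; this adds the 2 to
    the bound of [indicator_cos_gauss]. *)
Lemma poisson_sum_cos n a :
  `|\int[P]_w cos (\sum_(i < n) c i * N (B i) w + a)
    - expR (- (\sum_(i < n) c i ^+ 2 * m i / 2)) * cos a|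
  <= \sum_(i < n) (`|c i| ^+ 3 * m i + m i ^+ 2 * (2 + (1 + `|c i|) ^+ 4)).
Proof.
have m0 i : 0 <= m i by exact: fine_ge0.
set F := fun w => \sum_(i < n) c i * N (B i) w.
set s := \sum_(i < n) c i * m i.
pose D i := N (B i) @^-1` ~` [set - m i; 1 - m i].
have mD i : measurable (D i).
  by apply: measurable_funPTI; apply: measurableC; exact: measurableU.
have FS w : `|cos (F w + a) - cos (S n w + (a - s))| <= \sum_(i < n) 2 * \1_(D i) w.
  have cle2 (x y : R) : `|cos x - cos y| <= 2.
    by rewrite (le_trans (ler_normB _ _))// [leRHS](_ : 2 = 1 + 1)// lerD// cos_max.
  have D0 i : 0 <= 2 * \1_(D i) w :> R by rewrite mulr_ge0.
  have [/existsP[i Di]|/existsPn nD] := boolP [exists i : 'I_n, w \in D i].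
    rewrite (le_trans (cle2 _ _))// (bigD1 i)//= indicE Di mulr1.
    by rewrite lerDl sumr_ge0.
  rewrite (_ : F w + a = S n w + (a - s)); first by rewrite subrr normr0 sumr_ge0.
  rewrite addrCA addrC; congr (_ + _); rewrite /F /S /s -sumrB.
  apply: eq_bigr => i _; rewrite -mulrBr; congr (_ * _).
  have : ~ D i w by have := nD i; rewrite notin_setE.
  rewrite /D /= /void indicE => /contrapT[] NB.
    by rewrite mem_set// NB subrr sub0r.
  by rewrite memNset /= ?NB ?subr0// => /eqP; rewrite -subr_eq0 opprK subrK oner_eq0.
have mF : measurable_fun setT F.
  by apply: measurable_sum => i; exact: measurable_funM.
have mcosF : measurable_fun setT (fun w => cos (F w + a)).
  apply: (measurableT_comp (continuous_measurable_fun (@continuous_cos R))).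
  exact: measurable_funD.
have intF : P.-integrable setT (EFin \o (fun w => cos (F w + a))).
  by apply: (@bounded_integrable _ _ _ _ _ 1) => // w; exact: cos_max.
have intS : P.-integrable setT (EFin \o (fun w => cos (S n w + (a - s)))).
  by apply: (@bounded_integrable _ _ _ _ _ 1) => // w; exact: cos_max.
have mD2 : measurable_fun setT (fun w => \sum_(i < n) 2 * \1_(D i) w : R).
  by apply: measurable_sum => i; apply: measurable_funM => //; exact: measurable_indic.
have h1 : `|\int[P]_w cos (F w + a) - indicator_cos c m n (a - s)| <=
    \sum_(i < n) m i ^+ 2 * 2.
  rewrite -cosS_mean -RintegralB// -lee_fin.
  rewrite EFin_normr_Rintegral//; last first.
    by rewrite /comp; under eq_fun do rewrite EFinB; exact: integrableB.
  apply: (@le_trans _ _ (\int[P]_w (\sum_(i < n) 2 * \1_(D i) w)%:E)%E).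
    apply: (le_trans (le_abse_integral _ _ _)) => //.
      by apply/measurable_EFinP; exact: measurable_funB.
    apply: ge0_le_integral => //=.
    - by apply/measurable_EFinP; apply: measurableT_comp => //; exact: measurable_funB.
    - exact/measurable_EFinP.
    - by move=> w _; rewrite lee_fin.
  under eq_integral do rewrite -sumEFin.
  rewrite ge0_integral_sum//; last first.
    by move=> i; apply/measurable_EFinP/measurable_funM.
  rewrite -sumEFin; apply: lee_sum => i _.
  under eq_integral do rewrite EFinM.
  rewrite ge0_integralZl//; last by apply/measurable_EFinP; exact: measurable_indic.
  rewrite integral_indic// setIT mulrC EFinM lee_wpmul2l//.
  exact (compensated_poisson_ge2 HN (mB i) (Boo i)).
have h2 := indicator_cos_gauss c n a m0.
rewrite (le_trans (ler_distD (indicator_cos c m n (a - s)) _ _))//.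
apply: (le_trans (lerD h1 h2)); rewrite -big_split /=.
by rewrite le_eqVlt; apply/orP; left; apply/eqP/eq_bigr => i _; ring.
Qed.

End poisson_sum.

(** * The Lyapunov type bound *)

Section step_functions.
Context (T : Type) (R : realType) (B : nat -> set T).
Implicit Types (c : nat -> R) (n : nat) (z : T).

Lemma sum_indic_in c n k z : trivIset setT B -> (k < n)%N -> B k z ->
  \sum_(i < n) c i * \1_(B i) z = c k.
Proof.
move=> tB kn Bkz; rewrite (bigD1 (Ordinal kn))//= indicE mem_set// mulr1.
rewrite big1 ?addr0// => i ik; rewrite indicE memNset ?mulr0// => Biz.
have /(_ i k I I) := tB; move/(_ (ex_intro _ z (conj Biz Bkz))) => eik.
by move: ik; rewrite -val_eqE /= eik eqxx.
Qed.

Lemma sum_indic_notin c n z : (forall i, (i < n)%N -> ~ B i z) ->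
  \sum_(i < n) c i * \1_(B i) z = 0.
Proof.
by move=> nB; rewrite big1// => i _; rewrite indicE memNset ?mulr0//; exact: nB.
Qed.

Lemma sum_indic_comp c n (g : R -> R) z : trivIset setT B -> g 0 = 0 ->
  g (\sum_(i < n) c i * \1_(B i) z) = \sum_(i < n) g (c i) * \1_(B i) z.
Proof.
move=> tB g0; have [[k [kn Bkz]]|nB] := pselect (exists k, (k < n)%N /\ B k z).
  by rewrite (sum_indic_in c tB kn Bkz) (sum_indic_in (g \o c) tB kn Bkz).
have nB' i : (i < n)%N -> ~ B i z by move=> ni Biz; apply: nB; exists i.
by rewrite (sum_indic_notin c nB') (sum_indic_notin (g \o c) nB').
Qed.

End step_functions.

Lemma Rintegral_step (d : measure_display) (T : measurableType d) (R : realType)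
    (mu : {measure set T -> \bar R}) (B : nat -> set T) (c : nat -> R) n (g : R -> R) :
  trivIset setT B -> (forall i, measurable (B i)) -> (forall i, mu (B i) < +oo)%E ->
  g 0 = 0 -> (forall x, 0 <= g x) ->
  \int[mu]_z g (\sum_(i < n) c i * \1_(B i) z) =
  \sum_(i < n) g (c i) * fine (mu (B i)).
Proof.
move=> tB mB Boo g0 gge0; under eq_Rintegral do rewrite sum_indic_comp//.
rewrite /Rintegral; under eq_integral do rewrite -sumEFin.
rewrite ge0_integral_sum//; last 2 first.
- by move=> i; apply/measurable_EFinP/measurable_funM.
- by move=> i z _; rewrite lee_fin mulr_ge0.
rewrite (eq_bigr (fun i : 'I_n => (g (c i) * fine (mu (B i)))%:E)).
  by rewrite sumEFin.
move=> i _; under eq_integral do rewrite EFinM.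
rewrite ge0_integralZl ?lee_fin//; last exact/measurable_EFinP.
by rewrite integral_indic// setIT EFinM fineK// ge0_fin_numE.
Qed.

(** * Discretization of a kernel in value and in time *)

Section discretization.
Context (dU : measure_display) (U : measurableType dU) (R : realType).
Variables (nu : {sigma_finite_measure set U -> \bar R}) (h : U * R -> R).
Hypothesis mh : measurable_fun setT h.
Variable F : set U.
Hypotheses (mF : measurable F) (Foo : (nu F < +oo)%E).
Local Notation mu := (nu \x (@lebesgue_measure R))%E.
Variable n : nat.
Hypothesis n_gt0 : (0 < n)%N.

(* The domain where [h] is discretized with step [1/n]: [h] vanishes, is too
   large or is not supported on a set of finite measure elsewhere. *)
Definition step_domain : set (U * R) :=
  [set z | [/\ F z.1, `|z.2| <= n%:R & n%:R^-1 <= `|h z| <= n%:R]].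

(** On [step_domain] the number [n (h z + n)] lies between 0 and [2 n^2], so this counts its
    possible integer parts. *)
Let M := (2 * n ^ 2).+1.

(** The index codes a pair, as Poisson sums run over a sequence of sets: [k %% M] is the level of
    [h], and [k %/ M] is the time slice, of length [1 / q]. Slicing time makes the measure of a
    piece at most [nu F / q]. *)
Definition step_piece (q k : nat) : set (U * R) :=
  step_domain `&` [set z | (k %% M)%:R <= n%:R * (h z + n%:R) < (k %% M).+1%:R]
   `&` [set z | (k %/ M)%:R <= q%:R * (z.2 + n%:R) < (k %/ M).+1%:R].

Definition step_value (k : nat) : R := (k %% M)%:R / n%:R - n%:R.

(** For [|z.2| <= n] the integer part of [q (z.2 + n)] takes at most [2 n q + 1] values. *)
Definition step_size (q : nat) : nat := ((2 * n * q).+1 * M)%N.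

(** Rounding down to a multiple of [1 / n]. There is no [q] here: the same function is a sum over
    pieces as thin as desired. *)
Definition step_fun (z : U * R) : R :=
  if pselect (step_domain z) then (Num.truncn (n%:R * (h z + n%:R)))%:R / n%:R - n%:R
  else 0.

Let n0 : 0 < n%:R :> R. Proof. by rewrite ltr0n. Qed.

Lemma trivIset_step_piece q : trivIset setT (step_piece q).
Proof.
move=> k l _ _ [z [[[_ /andP[k1 k2]] /andP[k3 k4]] [[_ /andP[l1 l2]] /andP[l3 l4]]]].
have := le_lt_trans k1 l2; have := le_lt_trans l1 k2.
have := le_lt_trans k3 l4; have := le_lt_trans l3 k4.
rewrite !ltr_nat !ltnS => h1 h2 h3 h4.
rewrite (divn_eq k M) (divn_eq l M).
have -> : (k %% M = l %% M)%N by apply/eqP; rewrite eqn_leq h4 h3.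
by have -> : (k %/ M = l %/ M)%N by apply/eqP; rewrite eqn_leq h2 h1.
Qed.

Lemma norm_step_value k : `|step_value k| <= n%:R.
Proof.
have kM : (k %% M <= 2 * n ^ 2)%N by rewrite -ltnS ltn_mod.
rewrite ler_norml /step_value; apply/andP; split.
  by rewrite lerBrDl subrr divr_ge0.
rewrite lerBlDr ler_pdivrMr// -!natrD -natrM ler_nat (leq_trans kM)//.
by rewrite -mulnn mulnA mul2n addnn.
Qed.

Lemma step_funE q z :
  step_fun z = \sum_(k < step_size q.+1) step_value k * \1_(step_piece q.+1 k) z.
Proof.
rewrite /step_fun; case: pselect => [/= Dz|nDz]; last first.
  by rewrite sum_indic_notin// => k _ [[]].
have [Fz zn /andP[_ hn]] := Dz.
set a := Num.truncn _; pose b := Num.truncn (q.+1%:R * (z.2 + n%:R)).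
move: (zn) (hn); rewrite !ler_norml => /andP[zn1 zn2] /andP[hn1 hn2].
have a0 : 0 <= n%:R * (h z + n%:R) by rewrite mulr_ge0// -lerBlDr sub0r.
have b0 : 0 <= q.+1%:R * (z.2 + n%:R) by rewrite mulr_ge0// -lerBlDr sub0r.
have /andP[a1 a2] := truncn_itv a0; have /andP[b1 b2] := truncn_itv b0.
have aM : (a < M)%N.
  rewrite ltnS -(ler_nat R) (le_trans a1)// natrM natrX expr2 mulrCA ler_pM2l//.
  by rewrite mulr_natl mulr2n lerD.
have bM : (b <= 2 * n * q.+1)%N.
  rewrite -(ler_nat R) (le_trans b1)// natrM mulrC ler_pM2r// natrM.
  by rewrite mulr_natl mulr2n lerD.
have kdiv : ((b * M + a) %/ M = b)%N by rewrite divnMDl// divn_small// addn0.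
have kmod : ((b * M + a) %% M = a)%N by rewrite modnMDl modn_small.
have kK : (b * M + a < step_size q.+1)%N.
  rewrite /step_size (leq_trans (n := (b * M + M)%N))// ?ltn_add2l//.
  by rewrite -mulSnr leq_mul2r ltnS bM orbT.
rewrite (sum_indic_in (fun k => step_value k) (@trivIset_step_piece q.+1) kK).
  by rewrite /step_value kmod.
by split; [split => //|]; rewrite /= ?kmod ?kdiv; apply/andP.
Qed.

Lemma step_fun_close z : step_domain z -> `|h z - step_fun z| <= n%:R^-1.
Proof.
rewrite /step_fun; case: pselect => [/= [_ _ /andP[_ hn]] _|//].
move: hn; rewrite ler_norml => /andP[hn1 hn2].
have a0 : 0 <= n%:R * (h z + n%:R) by rewrite mulr_ge0// -lerBlDr sub0r.
have /andP[] := truncn_itv a0; set a := Num.truncn _ => a1 a2.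
rewrite (_ : h z - _ = (n%:R * (h z + n%:R) - a%:R) / n%:R); last first.
  by field; rewrite gt_eqF.
rewrite normrM normfV (ger0_norm (ltW n0)) ler_piMl ?invr_ge0//.
by rewrite ger0_norm ?subr_ge0// lerBlDl natr1 ltW.
Qed.

(** This is the purpose of the cut-off [n^-1 <= |h z|]: a rounding error of at most [1 / n] never
    exceeds [|h z|]. It yields domination by [h] and the bound [2 |h|] for the step function. *)
Lemma norm_step_funB z : `|h z - step_fun z| <= `|h z|.
Proof.
have [Dz|nDz] := pselect (step_domain z).
  by rewrite (le_trans (step_fun_close Dz))//; case: Dz => _ _ /andP[].
by rewrite /step_fun; case: pselect => [//|? /=]; rewrite subr0.
Qed.

Lemma measurable_step_piece q k : measurable (step_piece q k).
Proof.
have mn : measurable_fun setT (fun z : U * R => `|h z|) by exact: measurableT_comp.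
have m2 : measurable_fun setT (fun z : U * R => `|z.2|) by exact: measurableT_comp.
have mh' : measurable_fun setT (fun z : U * R => n%:R * (h z + n%:R)).
  by apply: measurable_funM => //; exact: measurable_funD.
have mq : measurable_fun setT (fun z : U * R => q%:R * (z.2 + n%:R)).
  by apply: measurable_funM => //; exact: measurable_funD.
have -> : step_piece q k = ((fst @^-1` F `&` (fun z => `|z.2|) @^-1` `]-oo, n%:R])
    `&` (fun z => `|h z|) @^-1` `[n%:R^-1, n%:R])
    `&` (fun z => n%:R * (h z + n%:R)) @^-1` `[(k %% M)%:R, (k %% M).+1%:R[
    `&` (fun z => q%:R * (z.2 + n%:R)) @^-1` `[(k %/ M)%:R, (k %/ M).+1%:R[.
  rewrite /step_piece /step_domain; apply/seteqP; split=> z /=; rewrite !in_itv/=.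
    by move=> [[[? ? ?] ?] ?].
  by move=> [[[[? ?] ?] ?] ?].
apply: measurableI; last by rewrite -[_ @^-1` _]setTI; exact: mq.
apply: measurableI; last by rewrite -[_ @^-1` _]setTI; exact: mh'.
apply: measurableI; last by rewrite -[_ @^-1` _]setTI; exact: mn.
apply: measurableI; last by rewrite -[_ @^-1` _]setTI; exact: m2.
by rewrite -[_ @^-1` _]setTI; exact: measurable_fst.
Qed.

Lemma step_piece_le q k : (mu (step_piece q.+1 k) <= nu F * (q.+1%:R^-1)%:E)%E.
Proof.
pose I : set R := `[(k %/ M)%:R / q.+1%:R - n%:R, (k %/ M).+1%:R / q.+1%:R - n%:R[%classic.
have mI : measurable I by exact: measurable_itv.
have lI : lebesgue_measure I = (q.+1%:R^-1)%:E.
  rewrite /I lebesgue_measure_itv/= lte_fin ltrD2r ltr_pM2r ?invr_gt0//.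
  by rewrite ltr_nat ltnSn -EFinB; congr EFin; rewrite -(natr1 (k %/ M)); ring.
have -> : (nu F * (q.+1%:R^-1)%:E = mu (F `*` I))%E.
  by rewrite product_measure1E//; congr (_ * _)%E; exact: esym lI.
apply: le_measure; rewrite ?inE.
- exact: measurable_step_piece.
- exact: measurableX.
move=> z [[[Fz _ _] _] /= /andP[k1 k2]]; split => //=.
rewrite /I /= in_itv/= lerBlDr ltrBrDr ler_pdivrMr// ltr_pdivlMr//.
by rewrite [_ * q.+1%:R]mulrC k1 k2.
Qed.

Lemma step_piece_lty q k : (mu (step_piece q.+1 k) < +oo)%E.
Proof.
apply: (le_lt_trans (step_piece_le q k)).
by rewrite lte_mul_pinfty// ?ltry// ge0_fin_numE.
Qed.

End discretization.

(** The cosine is 1-Lipschitz, and [|x| <= e + x^2 / e] plays the part of the Cauchy-Schwarz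
    inequality, with [e] left to be chosen. *)
Lemma expectation_cos_close (d : measure_display) (T : measurableType d)
    (R : realType) (P : probability T R) (X Y : T -> R) (th al e : R) :
  measurable_fun setT X -> measurable_fun setT Y ->
  P.-integrable setT (fun w => ((X w - Y w) ^+ 2)%:E) -> 0 < e ->
  `|\int[P]_w cos (th * X w + al) - \int[P]_w cos (th * Y w + al)| <=
  `|th| * (e + (\int[P]_w ((X w - Y w) ^+ 2)) / e).
Proof.
move=> mX mY iXY e0.
have icos (Z : T -> R) : measurable_fun setT Z ->
    P.-integrable setT (EFin \o (fun w => cos (th * Z w + al))).
  move=> mZ; apply: (@bounded_integrable _ _ _ _ _ 1).
    apply: (measurableT_comp (continuous_measurable_fun (@continuous_cos R))).
    by apply: measurable_funD => //; exact: measurable_funM.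
  by move=> w; exact: cos_max.
have iD : P.-integrable setT
    (EFin \o (fun w => cos (th * X w + al) - cos (th * Y w + al))).
  by rewrite /comp; under eq_fun do rewrite EFinB; apply: integrableB => //; exact: icos.
have iB : P.-integrable setT (EFin \o (fun w => (X w - Y w) ^+ 2 / e)).
  by rewrite /comp; under eq_fun do rewrite EFinM; exact: integrableZr.
have ic : P.-integrable setT (EFin \o cst e) by exact: finite_measure_integrable_cst.
have iS : P.-integrable setT (EFin \o (fun w => e + (X w - Y w) ^+ 2 / e)).
  by rewrite /comp; under eq_fun do rewrite EFinD; exact: (integrableD _ ic iB).
have iZ : P.-integrable setT (EFin \o (fun w => `|th| * (e + (X w - Y w) ^+ 2 / e))).
  by rewrite /comp; under eq_fun do rewrite EFinM; exact: integrableZl.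
rewrite -RintegralB//; [|exact: icos..].
rewrite (le_trans (le_normr_Rintegral _ _))//.
apply: (@le_trans _ _ (\int[P]_w (`|th| * (e + (X w - Y w) ^+ 2 / e)))).
  apply: le_Rintegral => //; first exact: integrable_norm.
  move=> w _; have := cosD_taylor0 (th * Y w + al) (th * (X w - Y w)).
  rewrite (_ : th * Y w + al + _ = th * X w + al); last by ring.
  move=> /le_trans; apply; rewrite normrM ler_wpM2l//.
  set D := X w - Y w; rewrite -(real_normK (num_real D)).
  have := normr_ge0 D; move: (`|D|) => x x0.
  rewrite -(ler_pM2r e0) mulrDl divfK ?gt_eqF//.
  by have := sqr_ge0 (x - e); nra.
by rewrite RintegralZl// RintegralD// Rintegral_probability_cst RintegralZr.
Qed.


(** * From step functions to square integrable kernels *)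

Section characteristic_function_bound.
Context (dU d : measure_display) (U : measurableType dU)
  (Omega : measurableType d) (R : realType).
Variables (nu : {sigma_finite_measure set U -> \bar R}) (P : probability Omega R).
Local Notation mu := (nu \x (@lebesgue_measure R))%E.
Variables (N : set (U * R) -> {RV P >-> R}) (J : (U * R -> R) -> Omega -> R).
Hypothesis HN : compensated_poisson_measure mu N.
Hypothesis HJ : wiener_ito_integral mu N J.
Variables (h : U * R -> R) (th al : R).
Hypothesis mh : measurable_fun setT h.

Section fixed_step.
Variables (F : set U) (n : nat).
Hypotheses (mF : measurable F) (Foo : (nu F < +oo)%E) (n_gt0 : (0 < n)%N).
Let s := step_fun h F n.

Let B q := step_piece h F n q.+1.
Let c := step_value R n.

Let mB q k : measurable (B q k). Proof. exact: measurable_step_piece. Qed.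

Let Boo q k : (mu (B q k) < +oo)%E. Proof. exact: step_piece_lty. Qed.

Let tB q : trivIset setT (B q). Proof. exact: trivIset_step_piece. Qed.

Let sE q : s = fun z => \sum_(k < step_size n q.+1) c k * \1_(B q k) z.
Proof. by apply/funext => z; rewrite /s (step_funE _ _ n_gt0 q). Qed.

Lemma step_fun_Lfun : s \in Lfun mu 2%:E.
Proof.
rewrite (sE 0).
by have [] := wiener_ito_indic_sum HJ c (step_size n 1) (mB 0) (Boo 0).
Qed.

Let sum_step_piece q :
  \sum_(k < step_size n q.+1) fine (mu (B q k)) <=
  fine (mu (F `*` `[- n%:R, n%:R])).
Proof.
have mI : measurable (`[- n%:R, n%:R]%classic : set R) by exact: measurable_itv.
have mFn : measurable (F `*` (`[- n%:R, n%:R]%classic : set R)).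
  exact: measurableX.
have Fnoo : (mu (F `*` `[(- n%:R)%R, n%:R]) < +oo)%E.
  rewrite product_measure1E//.
  have -> : forall x y : \bar R, (x * y = y * x)%E by exact: muleC.
  rewrite lte_mul_pinfty ?measure_ge0//.
    by rewrite ge0_fin_numE// [X in (X < _)%E]lebesgue_measure_itv/=; case: ifP => _; rewrite -?EFinB ltry.
rewrite -lee_fin fineK ?ge0_fin_numE// -sumEFin.
rewrite (eq_bigr (fun k : 'I__ => mu (B q k))); last first.
  by move=> k _; rewrite fineK// ge0_fin_numE.
rewrite -measure_bigsetU//; last exact: mB.
apply: le_measure; rewrite ?inE//; first by apply: bigsetU_measurable => k _; exact: mB.
move=> z; rewrite -bigcup_mkord => -[k _ [[[Fz zn _] _] _]]; split => //=.
by rewrite in_itv/= -ler_norml.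
Qed.

(** Neither side depends on [q], whereas the quadratic error of [poisson_sum_cos] is at most the
    largest [m k] times their sum times a constant, hence of order [1 / q]. *)
Lemma step_fun_cos :
  `|\int[P]_w cos (th * J s w + al)
    - expR (- (th ^+ 2 * (\int[mu]_z (s z ^+ 2)) / 2)) * cos al|
  <= `|th| ^+ 3 * \int[mu]_z (`|s z| ^+ 3).
Proof.
set W := fine (mu (F `*` `[- n%:R, n%:R])).
set K := 2 + (1 + `|th| * n%:R) ^+ 4.
apply/ler_addgt0Pr => e e0.
(* [W] bounds the total measure of the pieces, [K] the factor of [m k ^+ 2], as the values are at
   most [n], and [nu F / q.+1] a single piece. Their product is at most [e] for this [q]. *)
pose q := Num.truncn (fine (nu F) * K * W / e).
pose m k := fine (mu (B q k)).
have [_ Js] := wiener_ito_indic_sum HJ c (step_size n q.+1) (mB q) (Boo q).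
have := poisson_sum_cos HN HJ (fun k => th * c k) (mB q) (Boo q) (@tB q)
  (step_size n q.+1) al.
rewrite -/m.
have -> : \int[P]_w cos (\sum_(i < step_size n q.+1) th * c i * N (B q i) w + al) =
          \int[P]_w cos (th * J s w + al).
  have [mJs _] := (Lfun2P P _).1 (wiener_ito_Lfun HJ step_fun_Lfun).
  have mcos (X : Omega -> R) : measurable_fun setT X ->
      measurable_fun setT (fun w => (cos (X w))%:E).
    move=> mX; apply/measurable_EFinP.
    exact: (measurableT_comp (continuous_measurable_fun (@continuous_cos R))).
  congr fine; apply: ae_eq_integral => //.
  - apply: mcos; apply: measurable_funD => //.
    by apply: measurable_sum => i; exact: measurable_funM.
  - by apply: mcos; apply: measurable_funD => //; exact: measurable_funM.
  - apply: filterS Js => w; rewrite -sE => -> _; congr (cos (_ + _))%:E.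
    by rewrite mulr_sumr; apply: eq_bigr => i _; rewrite mulrA.
have -> : \sum_(i < step_size n q.+1) (th * c i) ^+ 2 * m i / 2 =
          th ^+ 2 * (\int[mu]_z (s z ^+ 2)) / 2.
  rewrite (sE q) (@Rintegral_step _ _ _ mu (B q) c _ (fun x => x ^+ 2) (@tB q) (mB q) (Boo q)) ?expr0n//; last exact: sqr_ge0.
  rewrite mulr_sumr mulr_suml; apply: eq_bigr => i _.
  by rewrite exprMn mulrA.
move=> hle; apply: (le_trans hle); rewrite big_split/=; apply: lerD.
  rewrite (sE q) (@Rintegral_step _ _ _ mu (B q) c _ (fun x => `|x| ^+ 3) (@tB q) (mB q) (Boo q)) ?normr0 ?expr0n//.
  by rewrite mulr_sumr ler_sum// => i _; rewrite normrM exprMn -[leLHS]mulrA.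
have m0 k : 0 <= m k by exact: fine_ge0.
have mq k : m k <= fine (nu F) / q.+1%:R.
  rewrite -lee_fin fineK ?ge0_fin_numE// EFinM fineK ?ge0_fin_numE//.
  exact: step_piece_le.
have K0 : 0 <= K by rewrite addr_ge0// exprn_ge0// addr_ge0// mulr_ge0.
apply: (@le_trans _ _ (\sum_(i < step_size n q.+1) (fine (nu F) / q.+1%:R * K) * m i)).
  apply: ler_sum => i _; rewrite -/(m i) expr2 -[leLHS]mulrA [leRHS]mulrC.
  apply: ler_wpM2l => //; apply: ler_pM => //.
  rewrite lerD2l lerXn2r ?nnegrE ?addr_ge0 ?mulr_ge0//.
  by rewrite lerD2l normrM ler_wpM2l// norm_step_value.
rewrite -mulr_sumr.
apply: (@le_trans _ _ (fine (nu F) / q.+1%:R * K * W)).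
  apply: ler_wpM2l; last exact: sum_step_piece.
  by rewrite mulr_ge0// divr_ge0// fine_ge0.
have : fine (nu F) * K * W / e <= q.+1%:R by apply/ltW; exact: real_truncnS_gt (num_real _).
rewrite ler_pdivrMr// => qe.
rewrite (_ : _ / _ * _ * _ = fine (nu F) * K * W / q.+1%:R); last by field.
by rewrite ler_pdivrMr// [leRHS]mulrC.
Qed.

End fixed_step.

Hypothesis h2 : h \in Lfun mu 2%:E.
Hypothesis h3 : (\int[mu]_z (`|h z| ^+ 3)%:E < +oo)%E.

(** Where [h] vanishes, so does the step function; any other point eventually enters the domain,
    where the rounding error is at most [1 / n.+1]. *)
Lemma step_fun_cvg (F : nat -> set U) (z : U * R) :
  nondecreasing_seq F -> \bigcup_n F n = setT ->
  step_fun h (F n) n.+1 z @[n --> \oo] --> h z.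
Proof.
move=> ndF FT; have [hz0|hz0] := eqVneq (h z) 0.
  apply: cvg_near_cst; apply: nearW => n; apply/eqP.
  by rewrite -subr_eq0 -normr_le0 distrC (le_trans (norm_step_funB _ _ _ _))// hz0 normr0.
have [k _ Fkz] : (\bigcup_n F n) z.1 by rewrite FT.
apply/cvgrPdist_le => e e0; near=> n.
have n0 : (0 < n)%N by near: n; exact: nbhs_infty_gt.
rewrite (le_trans (step_fun_close _ _)) //.
  split.
  - have kn : (k <= n)%N by near: n; exact: nbhs_infty_ge.
    by have /subsetPset := ndF _ _ kn; apply.
  - rewrite (@le_trans _ _ n%:R) ?ler_nat//.
    by near: n; exact: nbhs_infty_ger.
  - apply/andP; split; last first.
      rewrite (@le_trans _ _ n%:R) ?ler_nat//.
      by near: n; exact: nbhs_infty_ger.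
    rewrite invf_ple ?posrE ?normr_gt0//.
    rewrite (@le_trans _ _ n%:R) ?ler_nat//.
    by near: n; exact: nbhs_infty_ger.
rewrite invf_ple ?posrE// (@le_trans _ _ n%:R) ?ler_nat//.
by near: n; exact: nbhs_infty_ger.
Unshelve. all: by end_near. Qed.

(** The step functions tend to [h] in L^2, hence by the isometry their integrals tend to [J h] in
    L^2. The factor 8 is the cube of the 2 in [sle]. *)
Lemma wiener_ito_cos :
  `|\int[P]_w cos (th * J h w + al)
    - expR (- (th ^+ 2 * (\int[mu]_z (h z ^+ 2)) / 2)) * cos al|
  <= `|th| ^+ 3 * (8 * \int[mu]_z (`|h z| ^+ 3)).
Proof.
have /sigma_finiteP[F [FT ndF mF]] := sigma_finiteT nu.
pose s n := step_fun h (F n) n.+1.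
have s2 n : s n \in Lfun mu 2%:E.
  by have [mFn Fnoo] := mF n; exact: step_fun_Lfun.
have ms n : measurable_fun setT (s n) by have [] := (Lfun2P mu (s n)).1 (s2 n).
have sh z : s n z @[n --> \oo] --> h z by apply: step_fun_cvg.
have sB n z : `|h z - s n z| <= `|h z| by exact: norm_step_funB.
have sle n z : `|s n z| <= 2 * `|h z|.
  rewrite (_ : s n z = h z - (h z - s n z)); last by ring.
  by rewrite (le_trans (ler_normB _ _))// mulr2n mulrDl mul1r lerD.
have sqrle (x y : R) : `|x| <= `|y| -> x ^+ 2 <= y ^+ 2.
  by move=> xy; rewrite -(real_normK (num_real x)) -(real_normK (num_real y)) lerXn2r ?nnegrE.
have int4 : mu.-integrable setT (EFin \o (fun z => 4 * h z ^+ 2)).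
  (* One majorant [4 h^2] serves both [(h - s n)^2] and [(s n)^2]. *)
  by rewrite /comp; under eq_fun do rewrite EFinM; apply: integrableZl => //; exact: Lfun2_integrable_sqr.
have hs0 : \int[mu]_z ((h z - s n z) ^+ 2) @[n --> \oo] --> (0 : R).
  have [|||||_ _] := @dominated_convergence _ _ _ mu setT measurableT
    (fun n z => ((h z - s n z) ^+ 2)%:E) (cst 0%E) (EFin \o (fun z => 4 * h z ^+ 2)).
  - by move=> n; apply/measurable_EFinP/measurable_funX/measurable_funB => //; exact: ms.
  - by [].
  - apply: aeW => z _; apply: cvg_EFin; first exact: nearW.
    have c0 : h z - s n z @[n --> \oo] --> h z - h z.
      by apply: cvgB => //; exact: cvg_cst.
    have c1 : (h z - s n z) * (h z - s n z) @[n --> \oo] --> (h z - h z) * (h z - h z).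
      exact: cvgM.
    by rewrite subrr mulr0 in c1.
  - exact: int4.
  - apply: aeW => z n _; rewrite lee_fin ger0_norm ?sqr_ge0//=.
    rewrite (le_trans (sqrle _ _ (sB n z)))// ler_peMl ?sqr_ge0//.
    by rewrite ler1n.
  rewrite integral_cst// mul0e => /fine_cvg; exact.
have s2cvg : \int[mu]_z (s n z ^+ 2) @[n --> \oo] --> \int[mu]_z (h z ^+ 2).
  have [|||||_ _] := @dominated_convergence _ _ _ mu setT measurableT
    (fun n z => (s n z ^+ 2)%:E) (fun z => (h z ^+ 2)%:E) (EFin \o (fun z => 4 * h z ^+ 2)).
  - by move=> n; apply/measurable_EFinP/measurable_funX; exact: ms.
  - by apply/measurable_EFinP/measurable_funX.
  - apply: aeW => z _; apply: cvg_EFin; first exact: nearW.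
    have c1 : s n z * s n z @[n --> \oo] --> h z * h z by apply: cvgM.
    exact: c1.
  - exact: int4.
  - apply: aeW => z n _; rewrite lee_fin ger0_norm ?sqr_ge0//=.
    rewrite (_ : 4 * _ = (2 * h z) ^+ 2); last by ring.
    by apply: sqrle; rewrite normrM ger0_norm.
  move=> c; apply: fine_cvg; rewrite /Rintegral fineK//.
  exact/integrable_fin_num/Lfun2_integrable_sqr.
have s3 n : \int[mu]_z (`|s n z| ^+ 3) <= 8 * \int[mu]_z (`|h z| ^+ 3).
  have m3 (f : U * R -> R) : measurable_fun setT f ->
      measurable_fun setT (fun z => (`|f z| ^+ 3)%:E).
    by move=> mf; apply/measurable_EFinP/measurable_funX; exact: measurableT_comp.
  have i3 : mu.-integrable setT (EFin \o (fun z => `|h z| ^+ 3)).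
    apply/integrableP; split; first exact: m3.
    by under eq_integral do rewrite /= ger0_norm ?exprn_ge0//.
  have i38 : mu.-integrable setT (EFin \o (fun z => 8 * `|h z| ^+ 3)).
    by rewrite /comp; under eq_fun do rewrite EFinM; exact: integrableZl.
  have le38 z : `|s n z| ^+ 3 <= 8 * `|h z| ^+ 3.
    rewrite (_ : 8 * _ = (2 * `|h z|) ^+ 3); last by ring.
    by rewrite lerXn2r// nnegrE mulr_ge0.
  rewrite -RintegralZl//; apply: le_Rintegral => //.
  apply: le_integrable i38 => //; first exact: m3.
  by move=> z _; rewrite lee_fin ger0_norm ?exprn_ge0// (le_trans (le38 z))// ler_norm.
have mJh : measurable_fun setT (J h).
  by have [] := (Lfun2P P _).1 (wiener_ito_Lfun HJ h2).
have mJs n : measurable_fun setT (J (s n)).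
  by have [] := (Lfun2P P _).1 (wiener_ito_Lfun HJ (s2 n)).
have ccvg : \int[P]_w cos (th * J (s n) w + al) @[n --> \oo] -->
            \int[P]_w cos (th * J h w + al).
  apply/cvgrPdist_le => e e0.
  (* With squared L^2 distance at most [eta ^+ 2], [expectation_cos_close] at [eta] gives
     [2 |th| eta <= e]; the [+ 1] guards against [th = 0]. *)
  pose eta := e / (2 * (`|th| + 1)).
  have th1 : 0 < `|th| + 1 by rewrite ltr_wpDl.
  have eta0 : 0 < eta by rewrite divr_gt0// mulr_gt0.
  have eta20 : 0 < eta ^+ 2 by rewrite exprn_gt0.
  have hs1 : \forall n \near \oo, \int[mu]_z ((h z - s n z) ^+ 2) <= eta ^+ 2.
    exact: cvgr_le hs0 _ eta20.
  near=> n.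
  have hsn : \int[mu]_z ((h z - s n z) ^+ 2) <= eta ^+ 2 by near: n.
  have iJ := wiener_ito_sqrB HJ h2 (s2 n).
  have hs2 : (fun z => -1 * s n z + h z) \in Lfun mu 2%:E by exact: Lfun2D.
  have iJ2 : P.-integrable setT (fun w => ((J h w - J (s n) w) ^+ 2)%:E).
    apply/integrableP; split.
      by apply/measurable_EFinP/measurable_funX/measurable_funB.
    under eq_integral do rewrite /= ger0_norm ?sqr_ge0//.
    rewrite iJ; have /integrable_lty := Lfun2_integrable_sqr hs2.
    move=> /(_ measurableT); apply: le_lt_trans.
    rewrite le_eqVlt; apply/orP; left; apply/eqP; apply: eq_integral => z _.
    by congr (_ ^+ 2)%:E; ring.
  apply: (le_trans (expectation_cos_close th al mJh (mJs n) iJ2 eta0)).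
  rewrite [X in _ + X / _](_ : _ = \int[mu]_z ((h z - s n z) ^+ 2)); last first.
    by rewrite /Rintegral iJ.
  apply: (@le_trans _ _ (`|th| * (eta + eta))).
    by rewrite ler_wpM2l// lerD2l ler_pdivrMr// -expr2.
  rewrite (_ : eta + eta = e / (`|th| + 1)); last by rewrite /eta; field; rewrite gt_eqF.
  by rewrite mulrA ler_pdivrMr// mulrC ler_wpM2l ?lerDl// ltW.
have : `|\int[P]_w cos (th * J (s n) w + al)
    - expR (- (th ^+ 2 * (\int[mu]_z (s n z ^+ 2)) / 2)) * cos al| @[n --> \oo] -->
    `|\int[P]_w cos (th * J h w + al)
    - expR (- (th ^+ 2 * (\int[mu]_z (h z ^+ 2)) / 2)) * cos al|.
  apply: cvg_norm; apply: cvgB => //; apply: cvgMr_tmp.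
  have c1 : - (th ^+ 2 * (\int[mu]_z (s n z ^+ 2)) / 2) @[n --> \oo] -->
      - (th ^+ 2 * (\int[mu]_z (h z ^+ 2)) / 2).
    by apply: cvgN; apply: cvgMr_tmp; exact: cvgMl_tmp.
  exact: (continuous_cvg _ (@continuous_expR R _) c1).
move/cvgr_to_le; apply; apply: nearW => n.
have [mFn Fnoo] := mF n.
apply: (le_trans (step_fun_cos mFn Fnoo (ltn0Sn n))).
by apply: ler_wpM2l; [exact: exprn_ge0|exact: s3].
Unshelve. all: by end_near. Qed.

End characteristic_function_bound.

(** * Stochastic Fubini theorem *)

Section time_integral.
Context (d : measure_display) (S : measurableType d) (R : realType).
Variables (m : {sigma_finite_measure set S -> \bar R}) (T C : R) (Z : R -> S -> R).
Local Notation leb := (@lebesgue_measure R).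
Hypothesis T_gt0 : 0 < T.
Hypothesis mZ : measurable_fun setT (fun p : R * S => Z p.1 p.2).
Hypothesis Z_out : forall t s, t \notin `[0, T] -> Z t s = 0.
Hypothesis Z2 : forall t, (\int[m]_s (Z t s ^+ 2)%:E <= C%:E)%E.

(** It is applied to the process, to its kernel on the plane and to the scalar exponential weight.
    Integrating over the whole line is harmless since these vanish for [t] outside [[0, T]]. *)
Definition time_integral (s : S) : R := \int[leb]_t Z t s.

Let I : set R := `[0, T]%classic.

Let mI : measurable I. Proof. exact: measurable_itv. Qed.

Let lebI : leb I = T%:E.
Proof. by rewrite /I lebesgue_measure_itv/= lte_fin T_gt0 oppr0 adde0. Qed.

Let mZl t : measurable_fun setT (Z t).
Proof. exact: (measurableT_comp mZ (measurable_pair1 t)). Qed.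

Let mZr s : measurable_fun setT (Z ^~ s).
Proof. exact: (measurableT_comp mZ (measurable_pair2 s)). Qed.

Let C_ge0 : 0 <= C.
Proof.
rewrite -lee_fin (le_trans _ (Z2 0))// integral_ge0// => s _.
by rewrite lee_fin sqr_ge0.
Qed.

Lemma process_Lfun t : Z t \in Lfun m 2%:E.
Proof. by apply/Lfun2P; split => //; rewrite (le_lt_trans (Z2 t))// ltry. Qed.

Let integral_cst_I (c : R) : (\int[leb]_t (c * \1_I t)%:E = (c * T)%:E)%E.
Proof.
under eq_integral do rewrite EFinM.
rewrite integralZl//; last first.
  apply/integrableP; split; first exact/measurable_EFinP.
  under eq_integral do rewrite /= ger0_norm//.
  by rewrite integral_indic// setIT [X in (X < _)%E]lebI ltry.
by rewrite integral_indic// setIT [X in (_ * X)%E]lebI.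
Qed.

Let msqr : measurable_fun setT (fun p : R * S => (Z p.1 p.2 ^+ 2)%:E).
Proof. by apply/measurable_EFinP/measurable_funX. Qed.

Let integral_sqr :
  (\int[m]_s \int[leb]_t (Z t s ^+ 2)%:E <= (C * T)%:E)%E.
Proof.
have := fubini_tonelli (m1 := leb) (m2 := m) (fun p => (Z p.1 p.2 ^+ 2)%:E) msqr.
move=> <-; last by move=> p; rewrite lee_fin sqr_ge0.
rewrite -integral_cst_I; apply: ge0_le_integral => //=.
- by move=> t _; apply: integral_ge0 => s _; rewrite lee_fin sqr_ge0.
- apply: (measurable_fun_fubini_tonelli_F (fun p => (Z p.1 p.2 ^+ 2)%:E)) => //.
  by move=> p; rewrite lee_fin sqr_ge0.
- by apply/measurable_EFinP/measurable_funM.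
- move=> t _; have [tI|tI] := boolP (t \in `[0, T]).
    by rewrite indicE mem_set// mulr1.
  rewrite integral0_eq; first by rewrite lee_fin mulr_ge0.
  by move=> s _; rewrite Z_out// expr0n.
Qed.

Let msqrS : measurable_fun setT (fun s => (\int[leb]_t (Z t s ^+ 2)%:E)%E).
Proof.
apply: (measurable_fun_fubini_tonelli_G (m1 := leb) (fun p => (Z p.1 p.2 ^+ 2)%:E)) => //.
by move=> p; rewrite lee_fin sqr_ge0.
Qed.

Let isqrS : m.-integrable setT (fun s => (\int[leb]_t (Z t s ^+ 2)%:E)%E).
Proof.
apply/integrableP; split => //; rewrite (le_lt_trans _ (ltry (C * T)))//.
apply: le_trans integral_sqr; rewrite le_eqVlt; apply/orP; left; apply/eqP.
apply: eq_integral => s _; rewrite gee0_abs//.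
by apply: integral_ge0 => t _; rewrite lee_fin sqr_ge0.
Qed.

(** By Tonelli the mean of the squared L^2 norm of a path is finite, so almost every path has a
    finite one. *)
Let ae_path : {ae m, forall s, (Z ^~ s) \in Lfun leb 2%:E}.
Proof.
apply: filterS (integrable_ae measurableT isqrS) => s /(_ Logic.I).
rewrite ge0_fin_numE; last first.
  by apply: integral_ge0 => t _; rewrite lee_fin sqr_ge0.
by move=> Zoo; apply/Lfun2P; split; [exact: mZr|].
Qed.

Let indic_I_Lfun : (\1_I : R -> R) \in Lfun leb 2%:E.
Proof. by apply: indic_Lfun2 => //; rewrite [X in (X < _)%E]lebI ltry. Qed.

Let ZI t s : Z t s * \1_I t = Z t s.
Proof.
have [tI|tI] := boolP (t \in `[0, T]); first by rewrite indicE mem_set// mulr1.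
by rewrite Z_out// mul0r.
Qed.

Let path_integrable s : (Z ^~ s) \in Lfun leb 2%:E ->
  leb.-integrable setT (fun t => (Z t s)%:E).
Proof.
move=> Zs; have := integrableM_Lfun2 Zs indic_I_Lfun.
by under eq_fun do rewrite ZI.
Qed.

Let time_integral_sqr s : (Z ^~ s) \in Lfun leb 2%:E ->
  ((time_integral s ^+ 2)%:E <= T%:E * \int[leb]_t (Z t s ^+ 2)%:E)%E.
Proof.
move=> Zs; set A := time_integral s.
have iZ2 := Lfun2_integrable_sqr Zs.
have fZ2 : (\int[leb]_t (Z t s ^+ 2)%:E)%E \is a fin_num by exact: integrable_fin_num.
have e1 : \int[leb]_t (Z t s * \1_I t) = A.
  by apply: eq_Rintegral => t _; rewrite ZI.
have e2 : \int[leb]_t (\1_I t ^+ 2) = T.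
  rewrite -[RHS]/(fine T%:E) -[T]mul1r -integral_cst_I; congr fine.
  apply: eq_integral => t _; rewrite mul1r indicE.
  by case: (_ \in _); rewrite ?expr1n ?expr0n.
(* The Cauchy-Schwarz inequality against [\1_I], from the squared norm of the path minus its mean
   [A / T] on [[0, T]]. *)
have := @Rintegral_ge0 _ _ _ leb setT (fun t => (1 * Z t s + (- (A / T)) * \1_I t) ^+ 2).
rewrite RintegralX_lin// e1 e2 => /(_ (fun t _ => sqr_ge0 _)).
rewrite -(fineK fZ2) -EFinM lee_fin -/(\int[leb]_t (Z t s ^+ 2)).
set q := \int[leb]_t _ => h.
suff : 0 <= T * q - A ^+ 2 by rewrite subr_ge0.
rewrite (_ : _ - _ = T * (1 ^+ 2 * q + 2 * 1 * - (A / T) * A + (- (A / T)) ^+ 2 * T)).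
  by rewrite mulr_ge0// ltW.
by field; rewrite gt_eqF.
Qed.

Lemma measurable_time_integral : measurable_fun setT time_integral.
Proof.
apply: (measurableT_comp (fine_measurable measurableT)).
have mf : measurable_fun setT (fun p : R * S => (Z p.1 p.2)%:E) by exact/measurable_EFinP.
(* The integral is the difference of those of the positive and negative parts, and each is
   measurable in [s] by Tonelli. *)
rewrite (_ : (fun s => _) = (fun s =>
   (\int[leb]_t ((fun p : R * S => (Z p.1 p.2)%:E)^\+ (t, s)) -
    \int[leb]_t ((fun p : R * S => (Z p.1 p.2)%:E)^\- (t, s)))%E)).
  apply: emeasurable_funB.
    apply: (measurable_fun_fubini_tonelli_G (m1 := leb) ((fun p : R * S => (Z p.1 p.2)%:E)^\+)%E) => //.
    exact: measurable_funepos.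
  apply: (measurable_fun_fubini_tonelli_G (m1 := leb) ((fun p : R * S => (Z p.1 p.2)%:E)^\-)%E) => //.
  exact: measurable_funeneg.
by apply/funext => s; rewrite [LHS]integralE; congr (_ - _)%E;
  apply: eq_integral => t _; rewrite ?funeposE ?funenegE.
Qed.

Lemma time_integral_Lfun : time_integral \in Lfun m 2%:E.
Proof.
apply/Lfun2P; split; first exact: measurable_time_integral.
apply: (@le_lt_trans _ _ (\int[m]_s (T%:E * \int[leb]_t (Z t s ^+ 2)%:E))%E).
  apply: ae_ge0_le_integral => //.
  - by move=> s _; rewrite lee_fin sqr_ge0.
  - by apply/measurable_EFinP/measurable_funX; exact: measurable_time_integral.
  - move=> s _; apply: mule_ge0; first by rewrite lee_fin ltW.
    by apply: integral_ge0 => t _; rewrite lee_fin sqr_ge0.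
  - exact: measurable_funeM.
  - by apply: filterS ae_path => s Zs _; exact: time_integral_sqr.
have := integrableZl measurableT T isqrS.
by move/integrable_lty; apply.
Qed.

(** Fubini's theorem; the bound [|Z G| <= Z^2 + G^2] makes the integrand integrable on the product,
    with integral at most [(C + D) T]. *)
Lemma Rintegral_time_integralM (G : S -> R) : G \in Lfun m 2%:E ->
  \int[m]_s (time_integral s * G s) = \int[leb]_t (\int[m]_s (Z t s * G s)).
Proof.
move=> G2; have [mG G2oo] := (Lfun2P m G).1 G2.
pose f (p : R * S) := (Z p.1 p.2 * G p.2)%:E.
have mf : measurable_fun setT f.
  by apply/measurable_EFinP/measurable_funM => //; exact: measurableT_comp.
have iG := Lfun2_integrable_sqr G2.
pose D := fine (\int[m]_s (G s ^+ 2)%:E).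
have DE : (\int[m]_s (G s ^+ 2)%:E)%E = D%:E by rewrite fineK// integrable_fin_num.
have fle t : (\int[m]_s `|f (t, s)| <= ((C + D) * \1_I t)%:E)%E.
  have [tI|tI] := boolP (t \in `[0, T]); last first.
    rewrite integral0_eq; last by move=> s _; rewrite /f Z_out// mul0r abse0.
    rewrite lee_fin mulr_ge0// addr_ge0// fine_ge0// integral_ge0// => s _.
    by rewrite lee_fin sqr_ge0.
  rewrite indicE mem_set// mulr1 EFinD -DE.
  apply: (@le_trans _ _ (\int[m]_s (Z t s ^+ 2)%:E + \int[m]_s (G s ^+ 2)%:E)%E); last first.
    by rewrite leeD.
  have msq (g : S -> R) : measurable_fun setT g -> measurable_fun setT (fun s => (g s ^+ 2)%:E).
    by move=> mg; apply/measurable_EFinP/measurable_funX.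
  rewrite -ge0_integralD//; last 4 first.
  - by move=> s _; rewrite lee_fin sqr_ge0.
  - exact: msq.
  - by move=> s _; rewrite lee_fin sqr_ge0.
  - exact: msq.
  apply: ge0_le_integral => //.
  - apply: measurableT_comp => //.
    exact: (measurableT_comp mf (measurable_pair1 t)).
  - by apply: emeasurable_funD; exact: msq.
  - move=> s _; rewrite /f /= -EFinD lee_fin normrM.
    rewrite -(real_normK (num_real (Z t s))) -(real_normK (num_real (G s))).
    have := normr_ge0 (Z t s); have := normr_ge0 (G s).
    move: (`|G s|) (`|Z t s|) => x y x0 y0; have := sqr_ge0 (x - y); nra.
have iF : (leb \x m)%E.-integrable setT f.
  apply/integrable12ltyP => //.
  rewrite (le_lt_trans _ (ltry ((C + D) * T)))// -integral_cst_I.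
  apply: ge0_le_integral => //.
  - by move=> t _; exact: integral_ge0.
  - apply: (measurable_fun_fubini_tonelli_F (abse \o f)).
      exact: measurableT_comp.
    by move=> p; exact: abse_ge0.
  - by apply/measurable_EFinP/measurable_funM.
transitivity (fine (\int[m]_s \int[leb]_t f (t, s))).
  congr fine; apply: ae_eq_integral => //.
  - apply/measurable_EFinP/measurable_funM => //; exact: measurable_time_integral.
  - exact: measurable_fubini_G iF.
  - apply: filterS ae_path => s Zs _.
    rewrite /f /=; under [RHS]eq_integral do rewrite EFinM.
    rewrite integralZr//; last exact: path_integrable.
    rewrite EFinM fineK//; apply: integrable_fin_num => //.
    exact: path_integrable.
rewrite -(Fubini iF); congr fine; apply: eq_integral => t _.
by rewrite /Rintegral fineK//; apply: integrable_fin_num => //; apply: integrableM_Lfun2 => //; exact: process_Lfun.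
Qed.

End time_integral.

Section stochastic_fubini.
Context (dZ d : measure_display) (Z : measurableType dZ)
  (Omega : measurableType d) (R : realType).
Variables (mu : {sigma_finite_measure set Z -> \bar R}) (P : probability Omega R).
Variables (N : set Z -> {RV P >-> R}) (J : (Z -> R) -> Omega -> R).
Hypothesis HJ : wiener_ito_integral mu N J.
Variables (T C : R) (k : R -> Z -> R) (Y : R -> Omega -> R).
Hypothesis T_gt0 : 0 < T.
Hypothesis mk : measurable_fun setT (fun p : R * Z => k p.1 p.2).
Hypothesis k_out : forall t z, t \notin `[0, T] -> k t z = 0.
Hypothesis k2 : forall t, (\int[mu]_z (k t z ^+ 2)%:E <= C%:E)%E.
Hypothesis mY : measurable_fun setT (fun p : R * Omega => Y p.1 p.2).
Hypothesis Y_out : forall t w, t \notin `[0, T] -> Y t w = 0.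
Hypothesis YJ : forall t, {ae P, forall w, Y t w = J (k t) w}.

Let k_Lfun t : k t \in Lfun mu 2%:E.
Proof. exact: process_Lfun mk k2 t. Qed.

Let mYt t : measurable_fun setT (Y t).
Proof. exact: (measurableT_comp mY (measurable_pair1 t)). Qed.

Let mJ f : f \in Lfun mu 2%:E -> measurable_fun setT (J f).
Proof. by move=> f2; have [] := (Lfun2P P _).1 (wiener_ito_Lfun HJ f2). Qed.

Let Y2 t : (\int[P]_w (Y t w ^+ 2)%:E <= C%:E)%E.
Proof.
apply: le_trans (k2 t); rewrite -(wiener_ito_sqr HJ (k_Lfun t)).
rewrite le_eqVlt; apply/orP; left; apply/eqP; apply: ae_eq_integral => //.
- exact/measurable_EFinP/measurable_funX.
- by apply/measurable_EFinP/measurable_funX; exact: mJ.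
- by apply: filterS (YJ t) => w -> _.
Qed.

Let mulYJ t f : f \in Lfun mu 2%:E ->
  \int[P]_w (Y t w * J f w) = \int[mu]_z (k t z * f z).
Proof.
move=> f2; rewrite -(wiener_ito_inner HJ (k_Lfun t) f2).
congr fine; apply: ae_eq_integral => //.
- by apply/measurable_EFinP/measurable_funM => //; exact: mJ.
- by apply/measurable_EFinP/measurable_funM; exact: mJ.
- by apply: filterS (YJ t) => w -> _.
Qed.

Let mulYY t s : \int[P]_w (Y t w * Y s w) = \int[mu]_z (k t z * k s z).
Proof.
rewrite -mulYJ//; congr fine; apply: ae_eq_integral => //.
- exact/measurable_EFinP/measurable_funM.
- by apply/measurable_EFinP/measurable_funM => //; exact: mJ.
- by apply: filterS (YJ s) => w -> _.
Qed.

(* Both the time integral [A] of [Y] and [J H] have the same inner products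
   with [A] and with [J H], so that their difference is orthogonal to itself. *)
Lemma time_integral_wiener_ito :
  {ae P, forall w, time_integral Y w = J (time_integral k) w}.
Proof.
set A := time_integral Y; set H := time_integral k.
have H2 : H \in Lfun mu 2%:E by exact: time_integral_Lfun T_gt0 mk k_out k2.
have A2 : A \in Lfun P 2%:E by exact: time_integral_Lfun T_gt0 mY Y_out Y2.
have JH2 := wiener_ito_Lfun HJ H2.
have fubk := Rintegral_time_integralM T_gt0 mk k_out k2.
have fubY := Rintegral_time_integralM T_gt0 mY Y_out Y2.
have AJ : \int[P]_w (A w * J H w) = \int[mu]_z (H z * H z).
  by rewrite fubY// fubk//; apply: eq_Rintegral => t _; rewrite mulYJ.
have AY t : \int[P]_w (A w * Y t w) = \int[mu]_z (H z * k t z).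
  rewrite fubY; last exact: process_Lfun mY Y2 t.
  by rewrite fubk//; apply: eq_Rintegral => s _; rewrite mulYY.
have AA : \int[P]_w (A w ^+ 2) = \int[mu]_z (H z * H z).
  under eq_Rintegral do rewrite expr2.
  rewrite fubY// fubk//; apply: eq_Rintegral => t _.
  under eq_Rintegral do rewrite mulrC.
  by rewrite AY; apply: eq_Rintegral => z _; rewrite mulrC.
have JJ : \int[P]_w (J H w ^+ 2) = \int[mu]_z (H z * H z).
  under eq_Rintegral do rewrite expr2.
  exact: (wiener_ito_inner HJ H2 H2).
have D2 : (fun w => -1 * J H w + A w) \in Lfun P 2%:E by exact: Lfun2D.
have D0 : \int[P]_w ((1 * A w + (-1) * J H w) ^+ 2) = 0.
  by rewrite RintegralX_lin// AA AJ JJ; ring.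
have [mD _] := (Lfun2P P _).1 D2.
have : (\int[P]_w `|((-1 * J H w + A w) ^+ 2)%:E| = 0)%E.
  under eq_integral do rewrite /= ger0_norm ?sqr_ge0//.
  rewrite -[LHS]fineK; last exact/integrable_fin_num/Lfun2_integrable_sqr.
  rewrite -[X in X%:E]/(\int[P]_w ((-1 * J H w + A w) ^+ 2)); congr EFin.
  by rewrite -D0; apply: eq_Rintegral => w _; rewrite mul1r addrC.
move/(ae_eq_integral_abs P measurableT) => h.
have /h : measurable_fun setT (fun w => ((-1 * J H w + A w) ^+ 2)%:E).
  exact/measurable_EFinP/measurable_funX.
apply: filterS => w /(_ Logic.I)[/eqP].
by rewrite sqrf_eq0 mulN1r addrC subr_eq0 => /eqP.
Qed.

End stochastic_fubini.

(** * The Ornstein-Uhlenbeck kernel *)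

Section exponential_weight.
Variable R : realType.
Local Notation leb := (@lebesgue_measure R).
Implicit Types a x t : R.

Let is_derive_expRaff a x t : a != 0 ->
  is_derive t (1 : R) (fun t : R => - a^-1 * expR (- a * (t - x)))
    (expR (- a * (t - x))).
Proof.
move=> a0.
have da : is_derive t (1 : R) (fun t : R => - a * (t - x)) (- a).
  apply: (is_derive_eq (is_deriveZ (- a)
    (is_deriveB (is_derive_id t (1 : R)) (is_derive_cst x t (1 : R))))).
  by rewrite subr0 [LHS]mulr1.
have de := @is_derive1_comp R expR _ t _ _ (is_derive_expR _) da.
apply: (is_derive_eq (is_deriveZ (- a^-1) de)).
rewrite [LHS](_ : _ = - a^-1 * (expR (- a * (t - x)) * - a))//.
by field.
Qed.

Let continuous_expRaff a x : continuous (fun t : R => expR (- a * (t - x))).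
Proof.
move=> t.
have ca : {for t, continuous (fun t : R => - a * (t - x))}.
  by apply: cvgMl_tmp; apply: cvgB; [exact: cvg_id|exact: cvg_cst].
exact: (continuous_comp ca (@continuous_expR R _)).
Qed.

Let is_deriveW (F : R -> R) t df : is_derive t (1 : R) F df ->
  {for t, continuous F}.
Proof.
by move=> dF; apply/differentiable_continuous/derivable1_diffP; case: dF.
Qed.

Lemma integral_expR_tail a x : 0 < a ->
  (\int[leb]_(t in `[x, +oo[) (expR (- a * (t - x)))%:E = (a^-1)%:E)%E.
Proof.
move=> a0; have aN0 : a != 0 by rewrite gt_eqF.
rewrite (@ge0_continuous_FTC2y R _ (fun t => - a^-1 * expR (- a * (t - x))) x 0).
- by rewrite subrr mulr0 expR0 mulr1 -EFinB sub0r opprK.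
- by move=> t _; exact: expR_ge0.
- exact/continuous_subspaceT/continuous_expRaff.
- rewrite -[X in _ --> X](mulr0 (- a^-1)); apply: cvgMl_tmp.
  have cy : (t - x) * a @[t --> +oo] --> +oo.
    by apply/gt0_cvgMly => //; exact: cvg_addrr.
  have -> : (fun t => expR (- a * (t - x))) =
      (fun y : R => expR (- y)) \o (fun t => (t - x) * a).
    by apply/funext => t /=; rewrite mulNr mulrC.
  exact: (cvg_comp _ _ cy (@cvgr_expR R)).
- by move=> t _; case: (is_derive_expRaff x t aN0).
- by apply: cvg_at_right_filter; exact: (is_deriveW (is_derive_expRaff x x aN0)).
- by move=> t _; rewrite derive1E; case: (is_derive_expRaff x t aN0).
Qed.

Lemma integral_expR_lower a t : 0 < a ->
  (\int[leb]_(x in `]-oo, t]) (expR (- a * (t - x)))%:E = (a^-1)%:E)%E.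
Proof.
move=> a0; rewrite -[X in `]-oo, X]]opprK ge0_integration_by_substitutionNy.
- rewrite -(integral_expR_tail (- t) a0); apply: eq_integral => x _ /=.
  by rewrite !opprK addrC.
- apply/continuous_subspaceT => x.
  have ca : {for x, continuous (fun x : R => - a * (t - x))}.
    by apply: cvgMl_tmp; apply: cvgB; [exact: cvg_cst|exact: cvg_id].
  exact: (continuous_comp ca (@continuous_expR R _)).
- by move=> x _; exact: expR_ge0.
Qed.

Lemma integral_expR_segment a x y : 0 < a -> x <= y ->
  (\int[leb]_(t in `[x, y]) (expR (- a * (t - x)))%:E =
   ((1 - expR (- a * (y - x))) / a)%:E)%E.
Proof.
move=> a0; rewrite le_eqVlt => /predU1P[<-|xy].
  by rewrite set_itv1 integral_set1 subrr mulr0 expR0 subrr mul0r.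
have aN0 : a != 0 by rewrite gt_eqF.
rewrite (@continuous_FTC2 R _ (fun t => - a^-1 * expR (- a * (t - x))))//.
- by rewrite subrr mulr0 expR0 -EFinB; congr EFin; ring.
- exact/continuous_subspaceT/continuous_expRaff.
- split => [t _|/=|/=]; first by case: (is_derive_expRaff x t aN0).
  + by apply: cvg_at_right_filter; exact: (is_deriveW (is_derive_expRaff x x aN0)).
  + by apply: cvg_at_left_filter; exact: (is_deriveW (is_derive_expRaff x y aN0)).
- by move=> t _; rewrite derive1E; case: (is_derive_expRaff x t aN0).
Qed.

End exponential_weight.

Lemma ge0_integral_productM (d1 d2 : measure_display) (T1 : measurableType d1)
    (T2 : measurableType d2) (R : realType)
    (m1 : {sigma_finite_measure set T1 -> \bar R})
    (m2 : {sigma_finite_measure set T2 -> \bar R})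
    (f : T1 -> R) (g : T2 -> R) :
  measurable_fun setT f -> measurable_fun setT g ->
  (forall x, 0 <= f x) -> (forall y, 0 <= g y) ->
  (\int[m1 \x m2]_z (f z.1 * g z.2)%:E =
   \int[m1]_x (f x)%:E * \int[m2]_y (g y)%:E)%E.
Proof.
move=> mf mg f0 g0.
rewrite (fubini_tonelli1 (m1 := m1) (m2 := m2) (fun z => (f z.1 * g z.2)%:E)).
- rewrite -ge0_integralZr//; last 3 first.
  + exact/measurable_EFinP.
  + by move=> x _; rewrite lee_fin.
  + by apply: integral_ge0 => y _; rewrite lee_fin.
  apply: eq_integral => x _; rewrite /fubini_F /=.
  under eq_integral do rewrite EFinM.
  rewrite ge0_integralZl ?lee_fin//; first exact/measurable_EFinP.
  by move=> y _; rewrite lee_fin.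
- by apply/measurable_EFinP/measurable_funM; exact: measurableT_comp.
- by move=> z; rewrite lee_fin mulr_ge0.
Qed.

Section ou_weight.
Variables (R : realType) (lambda T : R).
Hypotheses (lambda_gt0 : 0 < lambda) (T_gt0 : 0 < T).
Local Notation leb := (@lebesgue_measure R).

(** The kernel without jump size and normalization, cut off to [[0, T]] in time to satisfy [Z_out].
    Its time integral is [(1 - exp (- lambda (T - x))) / lambda] for [x] in [[0, T]]. *)
Definition ou_weight (t x : R) : R :=
  if (0 <= t <= T) && (x <= t) then expR (- lambda * (t - x)) else 0.

Let G := time_integral ou_weight.

Let lambdaV_ge0 : 0 <= lambda^-1. Proof. by rewrite invr_ge0 ltW. Qed.

Lemma measurable_ou_weight :
  measurable_fun setT (fun p : R * R => ou_weight p.1 p.2).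
Proof.
apply: measurable_fun_ifT => //.
- apply: measurable_and; first apply: measurable_and.
  + exact: measurable_fun_ler.
  + exact: measurable_fun_ler.
  + exact: measurable_fun_ler.
- apply: measurableT_comp => //; apply: measurable_funM => //.
  exact: measurable_funB.
Qed.

Let mgt t : measurable_fun setT (ou_weight t).
Proof. exact: (measurableT_comp measurable_ou_weight (measurable_pair1 t)). Qed.

Let mgx x : measurable_fun setT (ou_weight ^~ x).
Proof. exact: (measurableT_comp measurable_ou_weight (measurable_pair2 x)). Qed.

Lemma ou_weight_ge0 t x : 0 <= ou_weight t x.
Proof. by rewrite /ou_weight; case: ifP => // _; exact: expR_ge0. Qed.

Lemma ou_weight_le1 t x : ou_weight t x <= 1.
Proof.
rewrite /ou_weight; case: ifP => // /andP[_ xt].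
by rewrite -expR0 ler_expR mulNr oppr_le0 mulr_ge0 ?subr_ge0// ltW.
Qed.

Lemma ou_weight_out t x : t \notin `[0, T] -> ou_weight t x = 0.
Proof. by rewrite in_itv/= /ou_weight => /negbTE ->. Qed.

Lemma integral_ou_weight_space t : (\int[leb]_x (ou_weight t x)%:E <= (lambda^-1)%:E)%E.
Proof.
rewrite -(integral_expR_lower t lambda_gt0) [leRHS]integral_mkcond.
apply: ge0_le_integral => //.
- by move=> x _; rewrite lee_fin ou_weight_ge0.
- by apply/measurable_EFinP; exact: mgt.
- apply/(measurable_restrictT _ _).1 => //; apply/measurable_EFinP/measurable_funTS.
  apply: measurableT_comp => //; apply: measurable_funM => //.
  exact: measurable_funB.
- move=> x _; rewrite patchE /ou_weight; have [xt|tx] := leP x t; last first.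
    by rewrite andbF; case: ifP => // _; rewrite lee_fin expR_ge0.
  rewrite andbT mem_set; last by rewrite /= in_itv.
  by rewrite lee_fin; case: ifP => // _; exact: expR_ge0.
Qed.

Let integral_ou_weight_time x : (\int[leb]_t (ou_weight t x)%:E <= (lambda^-1)%:E)%E.
Proof.
rewrite -(integral_expR_tail x lambda_gt0) [leRHS]integral_mkcond.
apply: ge0_le_integral => //.
- by move=> t _; rewrite lee_fin ou_weight_ge0.
- by apply/measurable_EFinP; exact: mgx.
- apply/(measurable_restrictT _ _).1 => //; apply/measurable_EFinP/measurable_funTS.
  apply: measurableT_comp => //; apply: measurable_funM => //.
  exact: measurable_funB.
- move=> t _; rewrite patchE /ou_weight; have [xt|tx] := leP x t; last first.
    by rewrite andbF; case: ifP => // _; rewrite lee_fin expR_ge0.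
  rewrite andbT mem_set; last by rewrite /= in_itv/= andbT.
  by rewrite lee_fin; case: ifP => // _; exact: expR_ge0.
Qed.

Let GE x : (G x)%:E = (\int[leb]_t (ou_weight t x)%:E)%E.
Proof.
rewrite /G /time_integral /Rintegral fineK// ge0_fin_numE.
  by rewrite (le_lt_trans (integral_ou_weight_time x))// ltry.
by apply: integral_ge0 => t _; rewrite lee_fin ou_weight_ge0.
Qed.

Let G_ge0 x : 0 <= G x.
Proof. by apply: Rintegral_ge0 => t _; exact: ou_weight_ge0. Qed.

Let G_le x : G x <= lambda^-1.
Proof. by rewrite -lee_fin GE. Qed.

Let mG : measurable_fun setT G.
Proof. exact: measurable_time_integral measurable_ou_weight. Qed.

Let integral_G : (\int[leb]_x (G x)%:E <= (T / lambda)%:E)%E.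
Proof.
under eq_integral do rewrite GE.
rewrite -(fubini_tonelli (m1 := leb) (m2 := leb) (fun p => (ou_weight p.1 p.2)%:E)).
- apply: (@le_trans _ _ (\int[leb]_t (lambda^-1 * \1_(`[0, T]%classic) t)%:E)%E).
    apply: ge0_le_integral => //.
    + by move=> t _; apply: integral_ge0 => x _; rewrite lee_fin ou_weight_ge0.
    + apply: (measurable_fun_fubini_tonelli_F (m2 := leb) (fun p => (ou_weight p.1 p.2)%:E)).
        by apply/measurable_EFinP; exact: measurable_ou_weight.
      by move=> p; rewrite lee_fin ou_weight_ge0.
    + by apply/measurable_EFinP/measurable_funM.
    + move=> t _; have [tI|tI] := boolP (t \in `[0, T]).
        by rewrite indicE mem_set// mulr1 integral_ou_weight_space.
      rewrite integral0_eq; first by rewrite lee_fin mulr_ge0.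
      by move=> x _; rewrite ou_weight_out.
  under eq_integral do rewrite EFinM.
  rewrite ge0_integralZl ?lee_fin//; last exact/measurable_EFinP.
  rewrite integral_indic// setIT [X in (_ * X)%E]lebesgue_measure_itv/= lte_fin T_gt0 oppr0 adde0.
  by rewrite -EFinM mulrC.
- by apply/measurable_EFinP; exact: measurable_ou_weight.
- by move=> p; rewrite lee_fin ou_weight_ge0.
Qed.

Let mGn n : measurable_fun setT (fun x => (G x ^+ n)%:E).
Proof. by apply/measurable_EFinP/measurable_funX. Qed.

(** The time integral of the weight is at most [lambda^-1] everywhere, and its own integral is at
    most [T / lambda]. The powers 2 and 3 give the variance and the Lyapunov term. *)
Lemma integral_ou_weightX n :
  (\int[leb]_x (time_integral ou_weight x ^+ n.+1)%:E <= (T / lambda ^+ n.+1)%:E)%E.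
Proof.
have ln0 : 0 <= lambda^-1 ^+ n by rewrite exprn_ge0.
apply: (@le_trans _ _ (\int[leb]_x (lambda^-1 ^+ n * G x)%:E)%E).
  apply: ge0_le_integral => //.
  - by move=> x _; rewrite lee_fin exprn_ge0.
  - exact: mGn.
  - by apply/measurable_EFinP/measurable_funM.
  - move=> x _; rewrite lee_fin exprSr ler_wpM2r//.
    by rewrite lerXn2r ?nnegrE.
under eq_integral do rewrite EFinM.
rewrite ge0_integralZl ?lee_fin//; last 2 first.
- exact/measurable_EFinP.
- by move=> x _; rewrite lee_fin.
apply: (le_trans (lee_wpmul2l _ integral_G)); first by rewrite lee_fin.
rewrite -EFinM lee_fin le_eqVlt; apply/orP; left; apply/eqP.
by rewrite exprVn exprS; field; rewrite expf_neq0 gt_eqF.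
Qed.

Let G_lower x : 0 <= x <= T -> (1 - expR (- lambda * (T - x))) / lambda <= G x.
Proof.
move=> /andP[x0 xT]; rewrite -lee_fin GE -integral_expR_segment//.
rewrite [leLHS]integral_mkcond; apply: ge0_le_integral => //.
- by move=> t _; rewrite patchE; case: ifP => // _; rewrite lee_fin expR_ge0.
- apply/(measurable_restrictT _ _).1 => //; apply/measurable_EFinP/measurable_funTS.
  apply: measurableT_comp => //; apply: measurable_funM => //.
  exact: measurable_funB.
- by apply/measurable_EFinP; exact: mgx.
- move=> t _; rewrite patchE; case: ifPn => [|_]; last by rewrite lee_fin ou_weight_ge0.
  rewrite inE/= in_itv/= => /andP[xt tT].
  by rewrite /ou_weight (le_trans x0 xt) tT xt.
Qed.

(** On [[0, T]], with [E = ou_weight T x], the square is at least [(1 - E)^2 / lambda^2], and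
    [(1 - E)^2 + 2 E >= 1]. The integral of [E] is at most [1 / lambda], whence the boundary term
    [2 / lambda^3]. It is moved to the right so that all integrands are nonnegative. *)
Lemma integral_ou_weight_sqr_lower :
  ((T / lambda ^+ 2 - 2 / lambda ^+ 3)%:E <=
   \int[leb]_x (time_integral ou_weight x ^+ 2)%:E)%E.
Proof.
have l2 : 0 <= 2 / lambda ^+ 2 by rewrite divr_ge0// exprn_ge0// ltW.
rewrite EFinB leeBlDr//.
apply: (@le_trans _ _ (\int[leb]_x (G x ^+ 2)%:E +
   \int[leb]_x (2 / lambda ^+ 2 * ou_weight T x)%:E)%E); last first.
  rewrite leeD2l//; under eq_integral do rewrite EFinM.
  rewrite ge0_integralZl ?lee_fin//; last 2 first.
  - by apply/measurable_EFinP; exact: mgt.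
  - by move=> x _; rewrite lee_fin ou_weight_ge0.
  apply: (le_trans (lee_wpmul2l _ (integral_ou_weight_space T))); first by rewrite lee_fin.
  rewrite -EFinM lee_fin le_eqVlt; apply/orP; left; apply/eqP.
  by field; rewrite gt_eqF.
rewrite -ge0_integralD//; last 4 first.
- by move=> x _; rewrite lee_fin sqr_ge0.
- exact: mGn.
- by move=> x _; rewrite lee_fin mulr_ge0// ou_weight_ge0.
- by apply/measurable_EFinP/measurable_funM => //; exact: mgt.
have -> : ((T / lambda ^+ 2)%:E =
    \int[leb]_x ((lambda ^+ 2)^-1 * \1_(`[0, T]%classic) x)%:E)%E.
  under eq_integral do rewrite EFinM.
  rewrite ge0_integralZl; last 4 first.
  - by [].
  - exact/measurable_EFinP.
  - by move=> x _; rewrite lee_fin.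
  - by rewrite lee_fin invr_ge0 exprn_ge0// ltW.
  rewrite integral_indic// setIT [X in (_ * X)%E]lebesgue_measure_itv/= lte_fin T_gt0 oppr0 adde0.
  by rewrite -EFinM mulrC.
apply: ge0_le_integral => //.
- by move=> x _; rewrite lee_fin mulr_ge0// invr_ge0 exprn_ge0// ltW.
- by apply/measurable_EFinP/measurable_funM.
- by apply: emeasurable_funD; [exact: mGn|apply/measurable_EFinP/measurable_funM => //; exact: mgt].
- move=> x _; rewrite -EFinD lee_fin.
  have [xI|xI] := boolP (x \in `[0, T]); last first.
    rewrite indicE memNset; last exact/negP.
    by rewrite mulr0 addr_ge0 ?sqr_ge0// mulr_ge0// ou_weight_ge0.
  rewrite indicE mem_set// mulr1.
  have xI' : 0 <= x <= T by rewrite in_itv in xI.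
  have /andP[_ xT] := xI'.
  have -> : ou_weight T x = expR (- lambda * (T - x)).
    by rewrite /ou_weight lexx (ltW T_gt0) xT.
  have := G_lower xI'; set E := expR _ => GE'.
  have E1 : 0 <= 1 - E.
    by rewrite subr_ge0 -expR0 ler_expR mulNr oppr_le0 mulr_ge0 ?subr_ge0// ltW.
  have : ((1 - E) / lambda) ^+ 2 <= G x ^+ 2.
    have q0 : 0 <= (1 - E) / lambda by rewrite divr_ge0// ltW.
    by rewrite lerXn2r ?nnegrE.
  have : 0 <= E ^+ 2 / lambda ^+ 2 by rewrite divr_ge0// ?sqr_ge0// exprn_ge0// ltW.
  rewrite exprMn exprVn; nra.
Qed.

End ou_weight.

(* In the library the canonical [SigmaFiniteMeasure] structure of [m1 \x m2]
   is that of a product of subprobabilities; a new constant is needed to carry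
   the one of a product of sigma-finite measures. *)
Definition sigma_finite_product (d1 d2 : measure_display)
    (T1 : measurableType d1) (T2 : measurableType d2) (R : realType)
    (m1 : {sigma_finite_measure set T1 -> \bar R})
    (m2 : {sigma_finite_measure set T2 -> \bar R}) : set (T1 * T2) -> \bar R :=
  (m1 \x m2)%E.

Section sigma_finite_product.
Context (d1 d2 : measure_display) (T1 : measurableType d1)
  (T2 : measurableType d2) (R : realType).
Variables (m1 : {sigma_finite_measure set T1 -> \bar R})
  (m2 : {sigma_finite_measure set T2 -> \bar R}).

HB.instance Definition _ := Measure.copy (sigma_finite_product m1 m2) (m1 \x m2)%E.

Lemma sigma_finite_productT : sigma_finite setT (sigma_finite_product m1 m2).
Proof.
have /sigma_finiteP[F [TF ndF Foo]] := sigma_finiteT m1.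
have /sigma_finiteP[G [TG ndG Goo]] := sigma_finiteT m2.
exists (fun n => F n `*` G n).
  rewrite -setXTT TF TG predeqE => -[x y]; split.
    move=> [/= [n _ Fnx] [k _ Gky]]; exists (maxn n k) => //; split.
    - by move: x Fnx; exact/subsetPset/ndF/leq_maxl.
    - by move: y Gky; exact/subsetPset/ndG/leq_maxr.
  by move=> [n _ []/= ? ?]; split; exists n.
move=> k; have [? ?] := Foo k; have [? ?] := Goo k.
split; first exact: measurableX.
rewrite /sigma_finite_product product_measure1E// lte_mul_pinfty//.
by rewrite ge0_fin_numE.
Qed.

HB.instance Definition _ := Measure_isSigmaFinite.Build _ _ _
  (sigma_finite_product m1 m2) sigma_finite_productT.

End sigma_finite_product.


(** * Moments of the time-integrated kernel *)

Section ou_noise.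
Variables (R : realType) (nu : {sigma_finite_measure set R -> \bar R}).
Variables (lambda T : R).
Hypotheses (lambda_gt0 : 0 < lambda) (T_gt0 : 0 < T).
Hypothesis nu2 : (\int[nu]_u (u ^+ 2)%:E = 1)%E.
Hypothesis nu3 : (\int[nu]_u (`|u| ^+ 3)%:E < +oo)%E.
Local Notation leb := (@lebesgue_measure R).
Local Notation mu := (nu \x leb)%E.

Definition ou_noise (t : R) (z : R * R) : R :=
  Num.sqrt (2 * lambda) * z.1 * ou_weight lambda T t z.2.

Let c := Num.sqrt (2 * lambda).
Let G := time_integral (ou_weight lambda T).

Let c2 : c ^+ 2 = 2 * lambda.
Proof. by rewrite sqr_sqrtr// mulr_ge0// ltW. Qed.

Let c_ge0 : 0 <= c. Proof. exact: sqrtr_ge0. Qed.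

Lemma ou_noise_out t z : t \notin `[0, T] -> ou_noise t z = 0.
Proof. by move=> tT; rewrite /ou_noise ou_weight_out// mulr0. Qed.

Lemma measurable_ou_noise :
  measurable_fun setT (fun p : R * (R * R) => ou_noise p.1 p.2).
Proof.
have m1 : measurable_fun setT (fun p : R * (R * R) => p.2.1).
  exact: measurableT_comp measurable_fst measurable_snd.
have m2 : measurable_fun setT (fun p : R * (R * R) => (p.1, p.2.2)).
  apply: measurable_fun_pair => //=.
  exact: measurableT_comp measurable_snd measurable_snd.
apply: measurable_funM; first exact: measurable_funM.
exact: (measurableT_comp (measurable_ou_weight lambda T) m2).
Qed.

Let mw t : measurable_fun setT (ou_weight lambda T t).
Proof.
exact: (measurableT_comp (measurable_ou_weight lambda T) (measurable_pair1 t)).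
Qed.

Let mG : measurable_fun setT G.
Proof. exact: measurable_time_integral (measurable_ou_weight lambda T). Qed.

Let G_ge0 x : 0 <= G x.
Proof. by apply: Rintegral_ge0 => t _; exact: ou_weight_ge0. Qed.

Let integral_product (g : R -> R) (n : nat) : measurable_fun setT g ->
  (forall x, 0 <= g x) ->
  (\int[mu]_z (`|c * z.1 * g z.2| ^+ n)%:E =
   (c ^+ n)%:E * (\int[nu]_u (`|u| ^+ n)%:E * \int[leb]_x (g x ^+ n)%:E))%E.
Proof.
move=> mg g0.
have m1 : measurable_fun setT (fun u : R => `|u| ^+ n).
  exact: measurable_funX.
have m2 : measurable_fun setT (fun x => g x ^+ n) by exact: measurable_funX.
rewrite -(ge0_integral_productM nu leb m1 m2 (fun u => exprn_ge0 n (normr_ge0 u))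
  (fun x => exprn_ge0 n (g0 x))).
rewrite -ge0_integralZl//; last 3 first.
- apply/measurable_EFinP/measurable_funM; first exact: (measurableT_comp m1 measurable_fst).
  exact: (measurableT_comp m2 measurable_snd).
- by move=> z _; rewrite lee_fin mulr_ge0// exprn_ge0.
- by rewrite lee_fin exprn_ge0.
apply: eq_integral => z _; rewrite -EFinM; congr EFin.
by rewrite !normrM (ger0_norm c_ge0) (ger0_norm (g0 _)) !exprMn mulrA.
Qed.

Let nu2' : (\int[nu]_u (`|u| ^+ 2)%:E = 1)%E.
Proof.
by rewrite -nu2; apply: eq_integral => u _; rewrite real_normK// num_real.
Qed.

(** As the weight is at most 1, its square is bounded by the weight itself, which gives
    [2 lambda / lambda = 2]. This is not sharp; what matters is uniformity in [t]. *)
Lemma ou_noise_sqr t : (\int[mu]_z (ou_noise t z ^+ 2)%:E <= 2%:E)%E.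
Proof.
have w0 := ou_weight_ge0 lambda T t.
under eq_integral do rewrite -(real_normK (num_real _)).
rewrite integral_product// nu2' mul1e c2.
apply: (@le_trans _ _ ((2 * lambda)%:E * (lambda^-1)%:E)%E); last first.
  by rewrite -EFinM mulfK// gt_eqF.
apply: lee_wpmul2l; first by rewrite lee_fin mulr_ge0// ltW.
apply: le_trans (integral_ou_weight_space T lambda_gt0 t).
apply: ge0_le_integral => //.
- by move=> x _; rewrite lee_fin sqr_ge0.
- by apply/measurable_EFinP/measurable_funX; exact: mw.
- by apply/measurable_EFinP; exact: mw.
- move=> x _; rewrite lee_fin expr2 ler_piMr//.
  exact: ou_weight_le1.
Qed.

Lemma time_integral_ou_noise z : time_integral ou_noise z = c * z.1 * G z.2.
Proof.
rewrite /time_integral RintegralZl//.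
have mI : measurable (`[0, T]%classic : set R) by exact: measurable_itv.
have i1 : leb.-integrable setT (fun t => (\1_(`[0, T]%classic) t : R)%:E).
  apply/integrableP; split; first exact/measurable_EFinP.
  under eq_integral do rewrite /= ger0_norm//.
  rewrite integral_indic// setIT [X in (X < _)%E]lebesgue_measure_itv/= lte_fin T_gt0.
  by rewrite oppr0 adde0 ltry.
apply: le_integrable i1 => //.
  apply/measurable_EFinP.
  exact: (measurableT_comp (measurable_ou_weight lambda T) (measurable_pair2 z.2)).
move=> t _; rewrite lee_fin !ger0_norm//; last exact: ou_weight_ge0.
have [tI|tI] := boolP (t \in `[0, T]); last by rewrite ou_weight_out.
by rewrite indicE mem_set// ou_weight_le1.
Qed.

Lemma ou_noise_Lfun : time_integral ou_noise \in Lfun mu 2%:E.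
Proof.
exact (@time_integral_Lfun _ _ R (sigma_finite_product nu leb) T 2 ou_noise
  T_gt0 measurable_ou_noise ou_noise_out ou_noise_sqr).
Qed.

Let time_integral_sqr :
  (\int[mu]_z (time_integral ou_noise z ^+ 2)%:E =
   (2 * lambda)%:E * \int[leb]_x (G x ^+ 2)%:E)%E.
Proof.
under eq_integral do rewrite -(real_normK (num_real _)) time_integral_ou_noise.
by rewrite integral_product// nu2' mul1e c2.
Qed.

(** The origin of the limit variance: [2 lambda] times [T / lambda^2], up to [2 lambda] times the
    boundary term [2 / lambda^3]. *)
Lemma ou_noise_sqr_bounds :
  2 / lambda * T - 4 / lambda ^+ 2 <=
  \int[mu]_z (time_integral ou_noise z ^+ 2) <= 2 / lambda * T.
Proof.
have l20 : 0 <= 2 * lambda by rewrite mulr_ge0// ltW.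
have up := integral_ou_weightX lambda_gt0 T_gt0 1.
have lo := integral_ou_weight_sqr_lower lambda_gt0 T_gt0.
have fG : (\int[leb]_x (G x ^+ 2)%:E)%E \is a fin_num.
  rewrite ge0_fin_numE; first by rewrite (le_lt_trans up)// ltry.
  by apply: integral_ge0 => x _; rewrite lee_fin sqr_ge0.
rewrite /Rintegral time_integral_sqr -(fineK fG) -EFinM /=.
rewrite -(fineK fG) lee_fin in up; rewrite -(fineK fG) lee_fin in lo.
apply/andP; split.
  rewrite (_ : _ - _ = 2 * lambda * (T / lambda ^+ 2 - 2 / lambda ^+ 3)).
    by rewrite ler_wpM2l.
  by field; rewrite gt_eqF.
rewrite (_ : 2 / lambda * T = 2 * lambda * (T / lambda ^+ 2)).
  by rewrite ler_wpM2l.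
by field; rewrite gt_eqF.
Qed.

Lemma ou_noise_cube :
  (\int[mu]_z (`|time_integral ou_noise z| ^+ 3)%:E <=
   (c ^+ 3 * fine (\int[nu]_u (`|u| ^+ 3)%:E) * (T / lambda ^+ 3))%:E)%E.
Proof.
under eq_integral do rewrite time_integral_ou_noise.
have n0 : (0 <= \int[nu]_u (`|u| ^+ 3)%:E)%E.
  by apply: integral_ge0 => u _; rewrite lee_fin exprn_ge0.
rewrite integral_product// -mulrA (EFinM (c ^+ 3)).
apply: lee_wpmul2l; first by rewrite lee_fin exprn_ge0.
rewrite EFinM fineK ?ge0_fin_numE//; apply: lee_wpmul2l => //.
exact: (integral_ou_weightX lambda_gt0 T_gt0 2).
Qed.

End ou_noise.

(** * The time average as a Wiener-Ito integral *)

Section ou_average.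
Context (R : realType) (d : measure_display) (Omega : measurableType d).
Variables (P : probability Omega R) (nu : {sigma_finite_measure set R -> \bar R}).
Hypothesis nu2 : (\int[nu]_u (u ^+ 2)%:E = 1)%E.
Hypothesis nu3 : (\int[nu]_u (`|u| ^+ 3)%:E < +oo)%E.
Variables (N : set (R * R) -> {RV P >-> R}) (J : (R * R -> R) -> Omega -> R).
Local Notation mu := (nu \x (@lebesgue_measure R))%E.
Hypothesis HN : compensated_poisson_measure mu N.
Hypothesis HJ : wiener_ito_integral mu N J.
Variable lambda : R.
Hypothesis lambda_gt0 : 0 < lambda.
Variable Y : R -> Omega -> R.
Hypothesis Ymeas : measurable_fun ([set t : R | 0 <= t] `*` [set: Omega])
  (fun p : R * Omega => Y p.1 p.2).
Hypothesis HY : forall t : R, 0 <= t ->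
  {ae P, forall w, Y t w = Num.sqrt (2 * lambda) * J (ou_kernel lambda t) w}.
Variable T : R.
Hypothesis T_gt0 : 0 < T.

Let X (w : Omega) : R :=
  (Num.sqrt T)^-1 * \int[lebesgue_measure]_(t in `[0, T]) Y t w.

Let k := ou_noise lambda T.
Let H := time_integral k.

(** Extension by 0, because [Y] is constrained for nonnegative times only and the stochastic Fubini
    theorem takes a process on the whole line that vanishes outside [[0, T]]. *)
Let YT (t : R) (w : Omega) : R := if t \in `[0, T] then Y t w else 0.

Let mYT : measurable_fun setT (fun p : R * Omega => YT p.1 p.2).
Proof.
have mD : measurable (`[0, T]%classic `*` setT : set (R * Omega)).
  by apply: measurableX => //; exact: measurable_itv.
have mY' : measurable_fun (`[0, T]%classic `*` [set: Omega]) (fun p : R * Omega => Y p.1 p.2).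
  apply: (measurable_funS _ _ Ymeas).
    apply: measurableX => //.
    rewrite (_ : [set _ | _] = `[0, +oo[%classic); first exact: measurable_itv.
    by apply/seteqP; split=> x /=; rewrite in_itv/= andbT.
  by move=> [t w] [/=]; rewrite in_itv/= => /andP[].
rewrite (_ : (fun _ => _) = (fun p : R * Omega => Y p.1 p.2) \_ (`[0, T]%classic `*` setT)).
  by apply: (measurable_restrictT _ mD).1.
apply/funext => -[t w]; rewrite patchE /YT /=.
have [tT|tT] := boolP (t \in `[0, T]); first by rewrite mem_set.
by rewrite memNset// => -[/= tT' _]; rewrite tT' in tT.
Qed.

Let XE w : X w = (Num.sqrt T)^-1 * time_integral YT w.
Proof.
rewrite /X Rintegral_mkcond; congr (_ * _); apply: eq_Rintegral => t _.
rewrite patchE /YT; have [tT|tT] := boolP (t \in `[0, T]); first by rewrite mem_set.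
by rewrite memNset//; exact/negP.
Qed.

Lemma measurable_ou_average : measurable_fun setT X.
Proof.
rewrite (_ : X = fun w => (Num.sqrt T)^-1 * time_integral YT w).
  by apply: measurable_funM => //; exact: measurable_time_integral.
by apply/funext => w; exact: XE.
Qed.

Let c_gt0 : 0 < Num.sqrt (2 * lambda). Proof. by rewrite sqrtr_gt0 mulr_gt0. Qed.

Let kE t : t \in `[0, T] -> k t = fun z => Num.sqrt (2 * lambda) * ou_kernel lambda t z.
Proof.
rewrite in_itv/= => tT; apply/funext => z; rewrite /k /ou_noise /ou_weight /ou_kernel tT/=.
by case: ifP => _; rewrite ?mulr0// mulrA.
Qed.

Let k_Lfun t : k t \in Lfun mu 2%:E.
Proof.
exact (@process_Lfun _ _ R (sigma_finite_product nu (@lebesgue_measure R)) 2 k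
  (measurable_ou_noise lambda T) (@ou_noise_sqr R nu lambda T lambda_gt0 nu2) t).
Qed.

Let ou_kernel_Lfun t : t \in `[0, T] -> ou_kernel lambda t \in Lfun mu 2%:E.
Proof.
move=> tT.
(* Scaling is the combination [a f + g] with [g = 0]; dividing by [sqrt (2 lambda)] recovers the
   kernel from [k t]. *)
have := Lfun2D (Num.sqrt (2 * lambda))^-1 (k_Lfun t) (Lfun_cst0 _).
rewrite kE// (_ : (fun z => _ + _) = ou_kernel lambda t)//.
by apply/funext => z; rewrite addr0 mulKf// gt_eqF.
Qed.

Let YTJ t : {ae P, forall w, YT t w = J (k t) w}.
Proof.
rewrite /YT; have [tT|tT] := boolP (t \in `[0, T]); last first.
  rewrite (_ : k t = fun=> 0); first by apply: filterS (wiener_ito0 HJ) => w ->.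
  by apply/funext => z; exact: ou_noise_out.
have t0 : 0 <= t by move: tT; rewrite in_itv/= => /andP[].
have := wiener_ito_lin HJ (Num.sqrt (2 * lambda)) (ou_kernel_Lfun tT) (Lfun_cst0 _).
rewrite (_ : (fun z => _ + 0) = k t); last first.
  by rewrite kE//; apply/funext => z; rewrite addr0.
move=> h; have hY := HY t0; have h0 := wiener_ito0 HJ.
by apply: filterS3 hY h h0 => w -> -> ->; rewrite addr0.
Qed.

Let XJ : {ae P, forall w, X w = (Num.sqrt T)^-1 * J H w}.
Proof.
have := @time_integral_wiener_ito _ _ _ _ R (sigma_finite_product nu (@lebesgue_measure R))
  P N J HJ T 2 k YT T_gt0 (measurable_ou_noise lambda T) (@ou_noise_out R lambda T)
  (@ou_noise_sqr R nu lambda T lambda_gt0 nu2) mYT _ YTJ.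
move=> h; have {}h := h (fun t w tT => ifN _ _ tT).
by apply: filterS h => w; rewrite XE => ->.
Qed.

Let H2 : H \in Lfun mu 2%:E.
Proof. exact: ou_noise_Lfun. Qed.

Let mJH : measurable_fun setT (J H).
Proof. by have [] := (Lfun2P P _).1 (wiener_ito_Lfun HJ H2). Qed.

Let sqrtT_gt0 : 0 < Num.sqrt T. Proof. by rewrite sqrtr_gt0. Qed.

Lemma ou_average_sqr : (\int[P]_w (X w ^+ 2)%:E <= (2 / lambda)%:E)%E.
Proof.
have -> : (\int[P]_w (X w ^+ 2)%:E = \int[P]_w ((T^-1)%:E * (J H w ^+ 2)%:E))%E.
  apply: ae_eq_integral => //.
  - by apply/measurable_EFinP/measurable_funX; exact: measurable_ou_average.
  - by apply: measurable_funeM; apply/measurable_EFinP/measurable_funX.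
  - apply: filterS XJ => w -> _; rewrite -EFinM; congr EFin.
    by rewrite exprMn exprVn sqr_sqrtr// ltW.
rewrite ge0_integralZl//; last 3 first.
- by apply/measurable_EFinP/measurable_funX.
- by move=> w _; rewrite lee_fin sqr_ge0.
- by rewrite lee_fin invr_ge0 ltW.
rewrite (wiener_ito_sqr HJ H2).
have /andP[_ up] := ou_noise_sqr_bounds lambda_gt0 T_gt0 nu2.
rewrite -[X in (_ * X)%E]fineK; last exact/integrable_fin_num/Lfun2_integrable_sqr.
rewrite -EFinM lee_fin mulrC ler_pdivrMr//; exact: up.
Qed.

Let v := \int[mu]_z (H z ^+ 2) / T.

(** This is [wiener_ito_cos] at frequency [th / sqrt T]: its cube contributes [T^(-3/2)] and the
    cube integral of [H] is of order [T]. *)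
Lemma ou_average_cos th al :
  `|\int[P]_w cos (th * X w + al) - expR (- (th ^+ 2 * v / 2)) * cos al|
  <= 8 * `|th| ^+ 3 *
     (Num.sqrt (2 * lambda) ^+ 3 * fine (\int[nu]_u (`|u| ^+ 3)%:E) / lambda ^+ 3)
     / Num.sqrt T.
Proof.
have cube := ou_noise_cube lambda_gt0 T_gt0 nu3.
have H3 : (\int[mu]_z (`|H z| ^+ 3)%:E < +oo)%E.
  by rewrite (le_lt_trans cube)// ltry.
have [mH _] := (Lfun2P mu _).1 H2.
have := wiener_ito_cos HN HJ (th / Num.sqrt T) al mH H2 H3.
have -> : \int[P]_w cos (th / Num.sqrt T * J H w + al) = \int[P]_w cos (th * X w + al).
  have mcos (x : R) (F : Omega -> R) : measurable_fun setT F ->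
      measurable_fun setT (fun w => (cos (x * F w + al))%:E).
    move=> mF; apply/measurable_EFinP.
    apply: (measurableT_comp (continuous_measurable_fun (@continuous_cos R))).
    by apply: measurable_funD => //; exact: measurable_funM.
  congr fine; apply: ae_eq_integral => //.
  - exact: mcos.
  - by apply: mcos; exact: measurable_ou_average.
  - by apply: filterS XJ => w -> _; rewrite mulrA.
have -> : (th / Num.sqrt T) ^+ 2 * (\int[mu]_z (H z ^+ 2)) / 2 = th ^+ 2 * v / 2.
  rewrite exprMn exprVn sqr_sqrtr ?ltW// /v; ring.
move=> /le_trans; apply.
rewrite normrM normfV (gtr0_norm sqrtT_gt0) exprMn exprVn.
set M3 := fine _ in cube *.
have cube' : \int[mu]_z (`|H z| ^+ 3) <= Num.sqrt (2 * lambda) ^+ 3 * M3 * (T / lambda ^+ 3).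
  rewrite -lee_fin fineK// ge0_fin_numE//.
  by apply: integral_ge0 => z _; rewrite lee_fin exprn_ge0.
have q0 : 0 <= `|th| ^+ 3 / Num.sqrt T ^+ 3 * 8.
  by rewrite !mulr_ge0// ?invr_ge0 ?exprn_ge0// ltW.
rewrite mulrA (le_trans (ler_wpM2l q0 cube'))//.
rewrite le_eqVlt; apply/orP; left; apply/eqP.
(* Writing [T] as the square of [sqrt T] leaves an identity of rational functions. *)
rewrite -[X in X / lambda ^+ 3](sqr_sqrtr (ltW T_gt0)).
by field; rewrite !gt_eqF.
Qed.

Lemma ou_average_variance : 2 / lambda - 4 / lambda ^+ 2 / T <= v <= 2 / lambda.
Proof.
have /andP[lo up] := ou_noise_sqr_bounds lambda_gt0 T_gt0 nu2.
rewrite /v ler_pdivrMr// up andbT ler_pdivlMr// mulrBl divfK ?gt_eqF//.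
Qed.

End ou_average.

Theorem theorem4 (R : realType) (d : measure_display)
    (Omega : measurableType d) (P : probability Omega R)
    (nu : {sigma_finite_measure set R -> \bar R})
    (nu2 : (\int[nu]_u (u ^+ 2)%:E = 1)%E)
    (nu3 : (\int[nu]_u (`|u| ^+ 3)%:E < +oo)%E)
    (N : set (R * R) -> {RV P >-> R})
    (HN : compensated_poisson_measure (nu \x lebesgue_measure)%E N)
    (J : (R * R -> R) -> Omega -> R)
    (HJ : wiener_ito_integral (nu \x lebesgue_measure)%E N J)
    (lambda : R) (lambda_gt0 : 0 < lambda)
    (Y : R -> Omega -> R)
    (Ymeas : measurable_fun ([set t : R | 0 <= t] `*` [set: Omega])
       (fun p : R * Omega => Y p.1 p.2))
    (HY : forall t : R, 0 <= t ->
       {ae P, forall w,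
         Y t w = Num.sqrt (2 * lambda) * J (ou_kernel lambda t) w}) :
  cvg_in_law P
    (fun T w => (Num.sqrt T)^-1 * \int[lebesgue_measure]_(t in `[0, T]) Y t w)
    (normal_prob 0 (Num.sqrt (2 * lambda^-1))).
Proof.
pose X (T : R) w := (Num.sqrt T)^-1 * \int[lebesgue_measure]_(t in `[0, T]) Y t w.
set s := Num.sqrt (2 * lambda^-1).
pose Q : probability (measurableTypeR R) R := normal_prob 0 s.
have s_gt0 : 0 < s by rewrite sqrtr_gt0 mulr_gt0// invr_gt0.
have s2 : s ^+ 2 = 2 / lambda by rewrite sqr_sqrtr// mulr_ge0// invr_ge0 ltW.
have mX : \forall T \near +oo, measurable_fun setT (X T).
  by near=> T; apply: measurable_ou_average => //.
(* One constant for both sides of the continuity theorem; for the Gaussian law finiteness of the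
   second moment is enough. *)
pose C := Num.max (2 / lambda) (fine (\int[Q]_x (x ^+ 2)%:E)%E).
have X2 : \forall T \near +oo, (\int[P]_w (X T w ^+ 2)%:E <= C%:E)%E.
  near=> T; apply: (@le_trans _ _ (2 / lambda)%:E).
    by apply: (ou_average_sqr nu2 HJ) => //.
  by rewrite lee_fin le_max lexx.
have Z2 : (\int[Q]_x (x ^+ 2)%:E <= C%:E)%E.
  have fin : (\int[Q]_x (x ^+ 2)%:E)%E \is a fin_num.
    rewrite ge0_fin_numE; first exact: normal_prob_sqr_lty.
    by apply: integral_ge0 => x _; rewrite lee_fin sqr_ge0.
  by rewrite -(fineK fin) lee_fin le_max lexx orbT.
split=> // f cf [M fM].
have mf := continuous_measurable_fun cf.
have fin_f : (\int[Q]_x (f x)%:E)%E \is a fin_num.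
  by apply: integrable_fin_num => //; exact: (@bounded_integrable _ _ _ Q f M).
(* Bounded functions have finite expectations, so that the limit may be taken in the reals. *)
rewrite -(fineK fin_f).
apply: (@cvg_trans _ ((\int[P]_w f (X T w))%:E @[T --> +oo])).
  apply: near_eq_cvg; near=> T; rewrite unlock /Rintegral fineK//.
  apply: integrable_fin_num => //; apply: (@bounded_integrable _ _ _ P (f \o X T) M).
    by apply: measurableT_comp => //; near: T.
  by move=> w; exact: fM.
apply/fine_cvgP; split; first exact: nearW.
have mid : measurable_fun setT (@id R) by exact: measurable_id.
apply: (@bounded_continuous_cvg _ _ _ _ _ P Q X id C) => // th al.
rewrite [X in _ --> X](Rintegral_cos_normal_prob th al s_gt0).
(* The variance of the average over [[0, T]]. The Lyapunov bound compares with a Gaussian of this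
   variance, which still has to converge to [2 / lambda]. *)
pose v T := \int[(nu \x (@lebesgue_measure R))%E]_z
  (time_integral (ou_noise lambda T) z ^+ 2) / T.
have Tinv : (T : R)^-1 @[T --> +oo] --> (0 : R).
  apply/gtr0_cvgV0; last exact: cvg_id.
  by near=> T; near: T; exact: nbhs_pinfty_gt.
have Tsqrt : (Num.sqrt T)^-1 @[T --> +oo] --> (0 : R).
  apply/gtr0_cvgV0.
    by near=> T; rewrite sqrtr_gt0; near: T; exact: nbhs_pinfty_gt.
  apply/cvgryPge => A; near=> T.
  have AT : A ^+ 2 <= T by near: T; apply: nbhs_pinfty_ge; exact: num_real.
  by rewrite (le_trans (ler_norm A))// -sqrtr_sqr ler_wsqrtr.
have v_cvg : v T @[T --> +oo] --> 2 / lambda.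
  apply: (@squeeze_cvgr _ _ _ _ (fun T => 2 / lambda - 4 / lambda ^+ 2 * T^-1)
    (fun=> 2 / lambda)).
  - by near=> T; apply: (ou_average_variance nu2 lambda_gt0).
  - rewrite -[X in _ --> X]subr0; apply: cvgB; first exact: cvg_cst.
    by rewrite -[X in _ --> X](mulr0 (4 / lambda ^+ 2)); exact: cvgMl_tmp.
  - exact: cvg_cst.
have e_cvg : expR (- (th ^+ 2 * v T / 2)) * cos al @[T --> +oo] -->
    expR (- ((s * th) ^+ 2 / 2)) * cos al.
  apply: cvgMr_tmp; rewrite exprMn s2 (mulrC (2 / lambda)).
  apply: (@cvg_comp _ _ _ (fun T => - (th ^+ 2 * v T / 2)) expR).
    apply: cvgN; apply: cvgMr_tmp.
    exact: (cvgMl_tmp v_cvg).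
  exact: continuous_expR.
(* It remains to see that the distance to the Gaussian of variance [v T] vanishes, and it is at most
   [K / sqrt T]. *)
apply: (cvg_sub0 _ e_cvg); apply: norm_cvg0.
pose K := 8 * `|th| ^+ 3 * (Num.sqrt (2 * lambda) ^+ 3 *
  fine (\int[nu]_u (`|u| ^+ 3)%:E)%E / lambda ^+ 3).
apply: (@squeeze_cvgr _ _ _ _ (fun=> 0) (fun T => K * (Num.sqrt T)^-1)).
- near=> T; rewrite normr_ge0/=.
  by apply: (ou_average_cos nu2 nu3 HN HJ lambda_gt0 Ymeas HY).
- exact: cvg_cst.
- by rewrite -[X in _ --> X](mulr0 K); exact: cvgMl_tmp.
Unshelve. all: by end_near. Qed.
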